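(* Let $\mathbb{K}$ be any countable field. Then there exists an associative $\mathbb{K}$-algebra $R$ such that: $R$ is $\mathbb{N}$-graded and generated as a $\mathbb{K}$-algebra by finitely many elements of degree one; $R$ is prime; $R$ is (Jacobson) radical, i.e. $R=J(R)$; $R$ is not nil; $R$ is not PI (it satisfies no polynomial identity); and $R$ has Gelfand-Kirillov dimension two.
   Context: Algebras are associative and not necessarily unital. An element $x$ of a ring $R$ is quasi-regular if there exists $y\in R$ with $x+y+xy=0$. The Jacobson radical $J(R)$ is the largest ideal of $R$ all of whose elements are quasi-regular, and $R$ is called radical if $R=J(R)$. A ring is nil if all its elements are nilpotent. If a $\mathbb{K}$-algebra $R$ is generated by a finite-dimensional subspace $V$, its Gelfand-Kirillov dimension is the infimum of those $d$ such that $\dim_{\mathbb{K}}(V+V^2+\cdots+V^n)$ grows slower than $n^d$ as $n\to\infty$. *)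

(* Defs.v *)
From HB Require Import structures.
From mathcomp Require Import all_boot all_order all_algebra.
From mathcomp Require Import finmap.
From mathcomp Require Import all_classical all_reals all_analysis.

Set Implicit Arguments.
Unset Strict Implicit.
Unset Printing Implicit Defensive.

Import Order.TTheory GRing.Theory Num.Theory.
Import numFieldNormedType.Exports.

Local Open Scope classical_set_scope.
Local Open Scope ring_scope.

(* Associative, not necessarily unital, K-algebras. *)
HB.mixin Record Lmodule_isNuAlgebra (K : fieldType) A of GRing.Lmodule K A := {
  numul : A -> A -> A;
  numulA : associative numul;
  numulDl : left_distributive numul +%R;
  numulDr : right_distributive numul +%R;
  numulZl : forall (c : K) (x y : A), numul (c *: x) y = c *: numul x y;
  numulZr : forall (c : K) (x y : A), numul x (c *: y) = c *: numul x y
}.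

#[short(type="nuAlgType")]
HB.structure Definition NuAlgebra (K : fieldType) :=
  {A of Lmodule_isNuAlgebra K A & GRing.Lmodule K A}.

Notation "x ** y" := (numul x y) (at level 40, left associativity) : ring_scope.

Section LinearAlgebra.
Context {K : fieldType} {V : lmodType K}.

Definition linear_subspace (W : set V) : Prop := submod_closed [in W].

Definition lspan (S : set V) : set V := smallest linear_subspace S.

Definition is_basis (W : set V) (m : nat) (e : 'I_m -> V) : Prop :=
  lspan (range e) = W /\
  forall c : 'I_m -> K, \sum_(i < m) c i *: e i = 0 -> forall i, c i = 0.

Definition has_dim (W : set V) (m : nat) : Prop :=
  exists e : 'I_m -> V, is_basis W e.

Definition finite_dim (W : set V) : Prop := exists m, has_dim W m.

(* Meaningful for finite-dimensional W; the value is 0 otherwise. *)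
Definition ldim (W : set V) : nat := xget 0%N [set m | has_dim W m].

End LinearAlgebra.

Section NuAlgebraTheory.
Context {K : fieldType} (A : nuAlgType K).
Implicit Types (x y : A) (I J S V W : set A).

Definition subalgebra S : Prop :=
  linear_subspace S /\ forall x y, S x -> S y -> S (x ** y).

Definition generates S : Prop := smallest subalgebra S = [set: A].

(* Two-sided ring ideals: no stability under scalars is required. *)
Definition ideal I : Prop :=
  zmod_closed [in I] /\ forall x y, I y -> I (x ** y) /\ I (y ** x).

Definition prime_algebra : Prop :=
  (exists x, x != 0) /\
  forall I J, ideal I -> ideal J ->
    (forall x y, I x -> J y -> x ** y = 0) -> I = [set 0] \/ J = [set 0].

Definition quasi_regular x : Prop := exists y, x + y + x ** y = 0.

Definition quasi_regular_ideal I : Prop :=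
  ideal I /\ forall x, I x -> quasi_regular x.

Definition is_jacobson_radical J : Prop :=
  quasi_regular_ideal J /\ forall I, quasi_regular_ideal I -> I `<=` J.

Definition radical_algebra : Prop := is_jacobson_radical [set: A].

(* [iter n (numul x) x] is the power of x with exponent n + 1. *)
Definition nilpotent_elt x : Prop := exists n, iter n (numul x) x = 0.

Definition nil_algebra : Prop := forall x, nilpotent_elt x.

(* A word in the variables indexed by nat, evaluated at a : nat -> A; there is
   no unit, so the empty word has no genuine value and gets the value 0. *)
Definition eval_word (a : nat -> A) (w : seq nat) : A :=
  if w is i :: t then foldl (fun x j => x ** a j) (a i) t else 0.

(* Elements of the free unital algebra over K on countably many noncommuting
   variables, as finitely supported functions on words. *)
Definition ncpoly := {fsfun seq nat -> K with 0}.

Definition eval_ncpoly (a : nat -> A) (f : ncpoly) : A :=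
  \sum_(w <- finsupp f) f w *: eval_word a w.

Definition PI_algebra : Prop :=
  exists f : ncpoly, [/\ exists w, f w != 0, f [::] = 0
    & forall a : nat -> A, eval_ncpoly a f = 0].

Definition is_grading (G : nat -> set A) : Prop :=
  [/\ forall n, linear_subspace (G n),
      forall m n x y, G m x -> G n y -> G (m + n)%N (x ** y),
      forall x, exists (N : nat) (c : nat -> A),
        (forall n, G n (c n)) /\ x = \sum_(n < N) c n
    & forall (N : nat) (c : nat -> A), (forall n, G n (c n)) ->
        \sum_(n < N) c n = 0 -> forall n, (n < N)%N -> c n = 0].

Definition space_mul V W : set A := lspan [set x ** y | x in V & y in W].

(* [space_exp V n] is V^(n+1). *)
Definition space_exp V (n : nat) : set A := iter n (space_mul V) V.

(* V + V^2 + ... + V^n *)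
Definition space_sum V (n : nat) : set A :=
  lspan (\bigcup_(k in `I_n) space_exp V k).

Definition growth V (n : nat) : nat := ldim (space_sum V n).

Definition GK_rate (R : realType) V : \bar R :=
  ereal_inf [set d%:E | d in
    [set d : R | (fun n => (growth V n)%:R : R^o) =o_\oo
                 (fun n => n%:R `^ d : R^o)]].

(* The rate does not depend on the generating subspace V. *)
Definition has_GKdim (R : realType) (g : \bar R) : Prop :=
  exists V, [/\ linear_subspace V, finite_dim V, generates V & GK_rate R V = g].

End NuAlgebraTheory.

(* Main.v *)
Require Import Defs.
From HB Require Import structures.
From mathcomp Require Import all_boot all_order all_algebra.
From mathcomp Require Import finmap.
From mathcomp Require Import zify ring lra.
From mathcomp Require Import all_classical all_reals all_analysis.

Set Implicit Arguments.
Unset Strict Implicit.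
Unset Printing Implicit Defensive.

Import Order.TTheory GRing.Theory Num.Theory.
Import numFieldNormedType.Exports.

Local Open Scope classical_set_scope.
Local Open Scope ring_scope.

(** Work in the free algebra on a = false and b = true, and start from p_0 = aa, q_0 = bb,
    seen as functionals on words.  At stage j, the functionals p_{j+1} and q_{j+1} are two
    linear combinations of the block words p^r E p^n q^(M-n), 0 <= n <= M, in p = p_j and
    q = q_j.  The algebra A is the quotient (without unit) by the ideal of all f such
    that p_j (u f v) = 0 for all j, u and v.
    - Since p_{j+1} starts with p_j p_j, two elements surviving at stage j have a nonzero
      product f z g at stage j+1, so A is prime.
    - For f without constant term, (1 + f)^-1 is a rational series T, so the functions
      w |-> T (u w v) span a finite-dimensional space.  Enumerating the countably many f,
      the combinations at stage j are chosen to kill this space for the j-th one; any long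
      window contains a complete block, so the homogeneous components of T of large degree
      vanish in A, and f is quasi-regular.
    - Sending both a and b b to a formal variable s turns p_j and q_j into polynomials in s;
      the combinations are chosen so that these are nonzero of different degrees, which
      is possible once M exceeds the number of linear constraints.  Nonvanishing at stage j
      says that some power of a + b b of exponent at least l_j / 2 is nonzero in A.
    - E runs over all block words, so A satisfies no polynomial identity.
    - A window of length m is made of about m / l_j blocks, and when r is large most of
      these are p_j; this yields dim A_m <= m * D_j with D_j independent of the r_i, hence
      negligible before l_j.  Conversely the windows p^t E p^n q^(M-n) p^t' with t, t' <= r
      yield r^2 independent elements in degree about 2 r l_j. *)

(** * Noncommutative power series *)

Section WordSums.
Variable V : zmodType.
Implicit Types (F G : seq bool -> V) (m n : nat).

(** For this recursive sum, splitting off the first letter is definitional, and [wsum_cat] is an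
    induction on the length of the prefix. *)
Fixpoint wsum n F : V :=
  if n is m.+1 then wsum m (fun w => F (false :: w)) + wsum m (fun w => F (true :: w))
  else F [::].

Lemma eq_wsum n F G : (forall w, size w = n -> F w = G w) -> wsum n F = wsum n G.
Proof.
elim: n F G => [|n IHn] F G eqFG /=; first exact: eqFG.
by congr (_ + _); apply: IHn => w szw; apply: eqFG; rewrite /= szw.
Qed.

Lemma wsumD n F G : wsum n (fun w => F w + G w) = wsum n F + wsum n G.
Proof. by elim: n F G => [|n IHn] F G //=; rewrite !IHn addrACA. Qed.

Lemma wsum0 n : wsum n (fun=> 0) = 0.
Proof. by elim: n => //= n ->; rewrite addr0. Qed.

Lemma wsum_eq0 n F : (forall w, size w = n -> F w = 0) -> wsum n F = 0.
Proof. by move=> F0; rewrite -[RHS](wsum0 n); exact: eq_wsum. Qed.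

Lemma wsum_big I (r : seq I) (P : pred I) n (F : I -> seq bool -> V) :
  wsum n (fun w => \sum_(i <- r | P i) F i w) = \sum_(i <- r | P i) wsum n (F i).
Proof.
elim: r => [|i r IHr].
  by rewrite big_nil -[RHS](wsum0 n); apply: eq_wsum => w _; rewrite big_nil.
rewrite big_cons -IHr; case Pi: (P i); last by apply: eq_wsum => w _; rewrite big_cons Pi.
by rewrite -wsumD; apply: eq_wsum => w _; rewrite big_cons Pi.
Qed.

Lemma wsum_cat m n F :
  wsum (m + n) F = wsum m (fun u => wsum n (fun v => F (u ++ v))).
Proof. by elim: m F => [|m IHm] F //=; rewrite !IHm. Qed.

Lemma wsum_exchange m n (F : seq bool -> seq bool -> V) :
  wsum m (fun u => wsum n (fun v => F u v)) = wsum n (fun v => wsum m (fun u => F u v)).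
Proof. by elim: m F => [|m IHm] F //=; rewrite !IHm -wsumD. Qed.

Lemma wsum_single n u F : size u = n ->
  (forall w, size w = n -> w != u -> F w = 0) -> wsum n F = F u.
Proof.
elim: n u F => [|n IHn] [|[] u] F //= [szu] F0.
- rewrite wsum_eq0 ?add0r; first by apply: IHn => // w szw wu; apply: F0; rewrite /= ?szw.
  by move=> w szw; apply: F0; rewrite /= ?szw.
- rewrite [X in _ + X]wsum_eq0 ?addr0.
    by apply: IHn => // w szw wu; apply: F0; rewrite /= ?szw.
  by move=> w szw; apply: F0; rewrite /= ?szw.
Qed.

End WordSums.

Lemma wsum_add (U V : zmodType) (h : {additive U -> V}) n (F : seq bool -> U) :
  h (wsum n F) = wsum n (fun w => h (F w)).
Proof. by elim: n F => [|n IHn] F //=; rewrite raddfD !IHn. Qed.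

Lemma wsumMl (R : pzRingType) n (c : R) (F : seq bool -> R) :
  wsum n (fun w => c * F w) = c * wsum n F.
Proof. by elim: n F => [|n IHn] F //=; rewrite !IHn mulrDr. Qed.

Lemma wsumMr (R : pzRingType) n (c : R) (F : seq bool -> R) :
  wsum n (fun w => F w * c) = wsum n F * c.
Proof. by elim: n F => [|n IHn] F //=; rewrite !IHn mulrDl. Qed.

Lemma wsum_neq0 (V : zmodType) n (F : seq bool -> V) :
  wsum n F != 0 -> exists2 w, size w = n & F w != 0.
Proof.
move=> sN0; apply: contrapT => H; move/eqP: sN0; apply; apply: wsum_eq0 => w szw.
by apply/eqP/negPn/negP => Fw; apply: H; exists w.
Qed.

(* Noncommutative formal power series in two letters; the multiplication is
   convolution, not the pointwise product. *)
Definition ncseries (K : Type) := seq bool -> K.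

Section Series.
Variable K : fieldType.

HB.instance Definition _ := GRing.Lmodule.copy (ncseries K) (seq bool -> K^o).

Implicit Types (f g h : ncseries K) (u v w : seq bool) (m n : nat).

Lemma serDE f g w : (f + g) w = f w + g w. Proof. by []. Qed.
Lemma serNE f w : (- f) w = - f w. Proof. by []. Qed.
Lemma serBE f g w : (f - g) w = f w - g w. Proof. by []. Qed.
Lemma serZE c f w : (c *: f) w = c * f w. Proof. by []. Qed.
Lemma ser0E w : (0 : ncseries K) w = 0. Proof. by []. Qed.

Definition mono u : ncseries K := fun w => (w == u)%:R.

Definition conv f g : ncseries K :=
  fun w => \sum_(i < (size w).+1) f (take i w) * g (drop i w).

Definition deriv1 (c : bool) f : ncseries K := fun w => f (c :: w).

Lemma conv_nil f g : conv f g [::] = f [::] * g [::].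
Proof. by rewrite /conv big_ord1. Qed.

Lemma conv_cons f g c w :
  conv f g (c :: w) = f [::] * g (c :: w) + conv (deriv1 c f) g w.
Proof. by rewrite /conv big_ord_recl. Qed.

Lemma conv_addl f1 f2 g : conv (f1 + f2) g = conv f1 g + conv f2 g.
Proof.
by apply/funext => w; rewrite serDE /conv -big_split; apply: eq_bigr => i _ /=; rewrite mulrDl.
Qed.

Lemma conv_addr f g1 g2 : conv f (g1 + g2) = conv f g1 + conv f g2.
Proof.
by apply/funext => w; rewrite serDE /conv -big_split; apply: eq_bigr => i _ /=; rewrite mulrDr.
Qed.

Lemma conv_scalel c f g : conv (c *: f) g = c *: conv f g.
Proof.
apply/funext => w; rewrite serZE /conv mulr_sumr.
by apply: eq_bigr => i _ /=; rewrite mulrA.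
Qed.

Lemma conv_scaler c f g : conv f (c *: g) = c *: conv f g.
Proof.
apply/funext => w; rewrite serZE /conv mulr_sumr.
by apply: eq_bigr => i _ /=; rewrite mulrCA.
Qed.

Lemma conv1l f : conv (mono [::]) f = f.
Proof.
apply/funext => w; rewrite /conv big_ord_recl take0 drop0 /mono eqxx mul1r.
rewrite big1 ?addr0 // => i _; case: w i => [|c w] i; first by case: i.
by rewrite /= mul0r.
Qed.

Lemma conv1r f : conv f (mono [::]) = f.
Proof.
apply/funext => w; rewrite /conv big_ord_recr take_size drop_size /mono eqxx mulr1.
rewrite big1 => [|i _]; first by rewrite /= add0r.
rewrite -size_eq0 size_drop subn_eq0 leqNgt /=.
by rewrite ltn_ord mulr0.
Qed.

(** Induction on the word, using the product rule of left derivatives: [deriv1 c] (f g) = f [::]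
    [deriv1 c] g + ([deriv1 c] f) g. *)
Lemma convA f g h : conv f (conv g h) = conv (conv f g) h.
Proof.
apply/funext => w; elim: w f g h => [|c w IHw] f g h; first by rewrite !conv_nil mulrA.
rewrite !conv_cons IHw conv_nil mulrDr mulrA -addrA; congr (_ + _).
have -> : deriv1 c (conv f g) = f [::] *: deriv1 c g + conv (deriv1 c f) g.
  by apply/funext => v; rewrite /deriv1 conv_cons.
by rewrite conv_addl conv_scalel.
Qed.

Lemma mono_nil_neq0 : mono [::] != 0.
Proof. by apply/eqP => /(congr1 (fun f => f [::])) /eqP; rewrite oner_eq0. Qed.

HB.instance Definition _ := GRing.Zmodule_isNzRing.Build (ncseries K)
  convA conv1l conv1r conv_addl conv_addr mono_nil_neq0.

HB.instance Definition _ := GRing.Lmodule_isLalgebra.Build K (ncseries K)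
  (fun c f g => esym (conv_scalel c f g)).

HB.instance Definition _ := GRing.Lalgebra_isAlgebra.Build K (ncseries K)
  (fun c f g => esym (conv_scaler c f g)).

Lemma ser1E w : (1 : ncseries K) w = (w == [::])%:R. Proof. by []. Qed.

Lemma ser_sumE I (r : seq I) (P : pred I) (F : I -> ncseries K) w :
  (\sum_(i <- r | P i) F i) w = \sum_(i <- r | P i) F i w.
Proof. by elim/big_rec2: _ => // i y1 y2 _ <-. Qed.

Lemma ser_wsumE n (F : seq bool -> ncseries K) w :
  (wsum n F) w = wsum n (fun u => F u w).
Proof. by elim: n F => [|n IHn] F //=; rewrite serDE !IHn. Qed.

Lemma serME f g w : (f * g) w = \sum_(i < (size w).+1) f (take i w) * g (drop i w).
Proof. by []. Qed.

Lemma serM_sum2 I J (r : seq I) (s : seq J) (c : I -> K) (d : J -> K)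
    (F : I -> ncseries K) (G : J -> ncseries K) w :
  ((\sum_(i <- r) c i *: F i) * (\sum_(j <- s) d j *: G j)) w =
  \sum_(i <- r) \sum_(j <- s) c i * d j * (F i * G j) w.
Proof.
elim: r => [|i r IHr]; first by rewrite !big_nil mul0r.
rewrite !big_cons mulrDl serDE IHr; congr (_ + _).
elim: s {IHr} => [|j s IHs]; first by rewrite !big_nil mulr0.
by rewrite !big_cons mulrDr serDE IHs -scalerAl -scalerAr scalerA serZE.
Qed.

Lemma serM_nil f g : (f * g) [::] = f [::] * g [::].
Proof. exact: conv_nil. Qed.

Lemma serM_cons f g c w : (f * g) (c :: w) = f [::] * g (c :: w) + (deriv1 c f * g) w.
Proof. exact: conv_cons. Qed.

(** Only one cut of the word contributes. This occurs when the first factor is homogeneous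
    ([hom_catE]) or when both degrees are bounded below ([serM_low]); most evaluations below rest on
    it. *)
Lemma serM_cat f g u v :
  (forall i, (i <= size (u ++ v))%N -> i != size u ->
     f (take i (u ++ v)) * g (drop i (u ++ v)) = 0) ->
  (f * g) (u ++ v) = f u * g v.
Proof.
move=> H; rewrite serME.
have lt : (size u < (size (u ++ v)).+1)%N by rewrite size_cat ltnS leq_addr.
rewrite (bigD1 (Ordinal lt)) //= take_size_cat // drop_size_cat // big1 ?addr0 //.
by move=> i ni; apply: H; [rewrite -ltnS | apply: contra ni => /eqP e; apply/eqP/val_inj].
Qed.

Definition homogeneous n f := forall w, size w != n -> f w = 0.

Lemma hom0 n : homogeneous n 0. Proof. by []. Qed.

Lemma homD n f g : homogeneous n f -> homogeneous n g -> homogeneous n (f + g).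
Proof. by move=> hf hg w sw; rewrite serDE hf ?hg ?addr0. Qed.

Lemma homZ n c f : homogeneous n f -> homogeneous n (c *: f).
Proof. by move=> hf w sw; rewrite serZE hf ?mulr0. Qed.

Lemma hom_sum n I (r : seq I) (P : pred I) (F : I -> ncseries K) :
  (forall i, P i -> homogeneous n (F i)) -> homogeneous n (\sum_(i <- r | P i) F i).
Proof. by move=> hF; elim/big_rec: _ => // i f Pi hf; apply: homD => //; exact: hF. Qed.

Lemma hom_mono u : homogeneous (size u) (mono u).
Proof. by move=> w; rewrite /mono; have [->|//] := eqVneq w u; rewrite eqxx. Qed.

Arguments hom_mono : clear implicits.

Lemma hom1 : homogeneous 0 1.
Proof. by move=> [|c w]. Qed.

Lemma hom_catE m f g u v : homogeneous m f -> size u = m -> (f * g) (u ++ v) = f u * g v.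
Proof.
move=> hf szu; apply: serM_cat => i lei ni; rewrite hf ?mul0r // size_takel //.
by rewrite -szu.
Qed.

Lemma homM m n f g : homogeneous m f -> homogeneous n g -> homogeneous (m + n) (f * g).
Proof.
move=> hf hg w sw; rewrite serME big1 // => i _.
have [szi|szi] := eqVneq (size (take i w)) m; last by rewrite hf ?mul0r.
rewrite hg ?mulr0 // size_drop; apply: contra sw => /eqP <-; rewrite -szi size_takel -1?ltnS //.
by rewrite subnKC // -ltnS.
Qed.

Lemma hom_prod n I (s : seq I) (F : I -> ncseries K) : (forall i, homogeneous n (F i)) ->
  homogeneous (size s * n) (\prod_(i <- s) F i).
Proof.
move=> hF; elim: s => [|i s IHs]; first by rewrite big_nil; exact: hom1.
by rewrite big_cons mulSn; exact: homM.
Qed.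

Lemma serM_low m n f g u v : (forall w, (size w < m)%N -> f w = 0) ->
  (forall w, (size w < n)%N -> g w = 0) -> size u = m -> size v = n ->
  (f * g) (u ++ v) = f u * g v.
Proof.
move=> f0 g0 su sv; apply: serM_cat => i lei ni.
have [lt|gt|/esym/eqP] := ltngtP i m; last by rewrite -su eq_sym (negPf ni).
  by rewrite f0 ?mul0r // size_takel.
by rewrite g0 ?mulr0 // size_drop size_cat; move: lei; rewrite size_cat; lia.
Qed.

Lemma serM_low0 m n f g w : (forall w, (size w < m)%N -> f w = 0) ->
  (forall w, (size w < n)%N -> g w = 0) -> (size w < m + n)%N -> (f * g) w = 0.
Proof.
move=> f0 g0 sw; rewrite serME big1 // => i _.
have [lt|ge] := ltnP i m; first by rewrite f0 ?mul0r // size_take; case: ifP => //; lia.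
by rewrite g0 ?mulr0 // size_drop; move: (ltn_ord i); lia.
Qed.

Lemma mono_cat u v : mono u * mono v = mono (u ++ v).
Proof.
apply/funext => w; have [e|ne] := eqVneq (size w) (size u + size v)%N; last first.
  by rewrite (homM (hom_mono u) (hom_mono v)) // (hom_mono (u ++ v)) // size_cat.
rewrite -(cat_take_drop (size u) w) (hom_catE _ _ (hom_mono u)); last first.
  by rewrite size_takel // e leq_addr.
rewrite /mono eqseq_cat ?size_takel ?e ?leq_addr //.
by rewrite -natrM mulnb.
Qed.

(** The bilinear form for which the words of length [n] are orthonormal: through it a series acts as
    a functional on the polynomials of degree [n]. *)
Definition pairing n f g : K := wsum n (fun w => f w * g w).

Lemma pairingDl n f1 f2 g : pairing n (f1 + f2) g = pairing n f1 g + pairing n f2 g.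
Proof. by rewrite /pairing -wsumD; apply: eq_wsum => w _; rewrite mulrDl. Qed.

Lemma pairingDr n f g1 g2 : pairing n f (g1 + g2) = pairing n f g1 + pairing n f g2.
Proof. by rewrite /pairing -wsumD; apply: eq_wsum => w _; rewrite mulrDr. Qed.

Lemma pairingZl n c f g : pairing n (c *: f) g = c * pairing n f g.
Proof. by rewrite /pairing -wsumMl; apply: eq_wsum => w _; rewrite mulrA. Qed.

Lemma pairingZr n c f g : pairing n f (c *: g) = c * pairing n f g.
Proof. by rewrite /pairing -wsumMl; apply: eq_wsum => w _; rewrite mulrCA. Qed.

Lemma pairing0l n g : pairing n 0 g = 0.
Proof. by apply: wsum_eq0 => w _; rewrite mul0r. Qed.

Lemma pairing_suml n I (r : seq I) (P : pred I) (F : I -> ncseries K) g :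
  pairing n (\sum_(i <- r | P i) F i) g = \sum_(i <- r | P i) pairing n (F i) g.
Proof.
elim/big_rec2: _ => [|i y1 y2 _ <-]; [exact: pairing0l | exact: pairingDl].
Qed.

Lemma pairing_mono u f : pairing (size u) f (mono u) = f u.
Proof.
rewrite /pairing (wsum_single (u := u)) // /mono; first by rewrite eqxx mulr1.
by move=> w _ /negPf ->; rewrite mulr0.
Qed.

Lemma pairing_hom0 n m f g : homogeneous m g -> n != m -> pairing n f g = 0.
Proof. by move=> hg nm; apply: wsum_eq0 => w sw; rewrite hg ?mulr0 // sw. Qed.

Lemma pairingM m n f1 f2 g1 g2 : homogeneous m f1 -> homogeneous m g1 ->
  pairing (m + n) (f1 * f2) (g1 * g2) = pairing m f1 g1 * pairing n f2 g2.
Proof.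
move=> h1 h2; rewrite /pairing wsum_cat -wsumMr; apply: eq_wsum => u su.
by rewrite -wsumMl; apply: eq_wsum => v sv; rewrite !(hom_catE (m := m)) // mulrACA.
Qed.

Definition hcomp n f : ncseries K := fun w => if size w == n then f w else 0.

Lemma hom_hcomp n f : homogeneous n (hcomp n f).
Proof. by move=> w /negPf sw; rewrite /hcomp sw. Qed.

Lemma ser_neq0 f : f != 0 -> exists w, f w != 0.
Proof.
move=> /eqP fN0; apply: contrapT => H; apply: fN0; apply/funext => w.
by apply/eqP/negPn/negP => fw; apply: H; exists w.
Qed.

Lemma hom_neq0 n f w : homogeneous n f -> f w != 0 -> size w = n.
Proof. by move=> hf; apply: contraNeq => /hf ->. Qed.

Lemma hom_mul_neq0 m f g : homogeneous m f -> f != 0 -> g != 0 -> f * g != 0.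
Proof.
move=> hf /ser_neq0[u fu] /ser_neq0[v gv]; apply/eqP => /(congr1 (@^~ (u ++ v))).
rewrite (hom_catE _ _ hf) ?(hom_neq0 hf fu) // => /eqP.
by rewrite mulf_eq0 (negPf fu) (negPf gv).
Qed.

Lemma hcomp_wsum n f : hcomp n f = wsum n (fun u => f u *: mono u).
Proof.
apply/funext => w; rewrite ser_wsumE /hcomp; case: eqP => [sw|/eqP sw].
  rewrite (wsum_single (u := w)) // ?serZE /mono ?eqxx ?mulr1 // => v _ vw.
  by rewrite serZE /mono eq_sym (negPf vw) mulr0.
by rewrite wsum_eq0 // => u su; rewrite serZE hom_mono ?mulr0 // su.
Qed.

End Series.

Arguments hom_mono {K}.

(** * Quotient algebras *)

Section Quotient.
Variables (K : fieldType) (P : ncseries K -> Prop) (I : Type)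
  (ev : ncseries K -> I -> K^o).
Hypotheses (P0 : P 0) (PL : forall c f g, P f -> P g -> P (c *: f + g))
  (PM : forall f g, P f -> P g -> P (f * g)).
Hypothesis evL : forall c f g, ev (c *: f + g) = c *: ev f + ev g.
Hypothesis ev_ideal : forall f g, P f -> P g -> ev f = 0 -> ev (f * g) = 0 /\ ev (g * f) = 0.

(** The quotient of [P] by the kernel of [ev] is realised as the image of [ev] in a function space,
    so that equality of classes is equality of functions. The proofs passed as arguments let the
    closure instance be attached to the predicate. *)
Definition quot_pred (_ : forall c f g, ev (c *: f + g) = c *: ev f + ev g)
  (_ : P 0) (_ : forall c f g, P f -> P g -> P (c *: f + g)) : {pred (I -> K^o)} :=
  fun phi => `[< exists2 f, P f & phi = ev f >].

Local Notation qp := (quot_pred evL P0 PL).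

Let ev0 : ev 0 = 0.
Proof. by have := evL (-1) 0 0; rewrite scaleN1r oppr0 addr0 scaleN1r addNr. Qed.

Fact quot_submod_closed : submod_closed qp.
Proof.
split=> [|c phi psi /asboolP[f Pf ->] /asboolP[g Pg ->]].
  by apply/asboolP; exists 0.
by apply/asboolP; exists (c *: f + g); [exact: PL | rewrite evL].
Qed.

HB.instance Definition _ := GRing.isSubmodClosed.Build K (I -> K^o) qp quot_submod_closed.

Record quot := Quot { quot_val : I -> K^o; quot_valP : quot_val \in qp }.

HB.instance Definition _ := [isSub for quot_val].
HB.instance Definition _ := [Choice of quot by <:].
HB.instance Definition _ := [SubChoice_isSubLmodule of quot by <:].

Fact quot_rep_subproof (x : quot) : exists f, P f /\ \val x = ev f.
Proof. by have /asboolP[f Pf e] := valP x; exists f. Qed.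

Definition quot_rep x := sval (cid (quot_rep_subproof x)).

Lemma quot_repP x : P (quot_rep x) /\ \val x = ev (quot_rep x).
Proof. exact: (svalP (cid (quot_rep_subproof x))). Qed.

Definition quot_pi (f : ncseries K) : quot := insubd 0 (ev f).

Lemma quot_piE f : P f -> \val (quot_pi f) = ev f.
Proof. by move=> Pf; rewrite insubdK //; apply/asboolP; exists f. Qed.

Lemma quot_pi_rep x : quot_pi (quot_rep x) = x.
Proof. by apply/val_inj; have [Pr e] := quot_repP x; rewrite quot_piE. Qed.

Definition quot_mul x y := quot_pi (quot_rep x * quot_rep y).

(** The product goes through chosen representatives; it does not depend on them because f' g' - f g
    = f' (g' - g) + (f' - f) g lies in the kernel of [ev]. *)
Lemma quot_piM f g : P f -> P g -> quot_mul (quot_pi f) (quot_pi g) = quot_pi (f * g).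
Proof.
move=> Pf Pg; apply/val_inj; rewrite /quot_mul.
have [Pf' ef] := quot_repP (quot_pi f); have [Pg' eg] := quot_repP (quot_pi g).
set f' := quot_rep _ in Pf' ef *; set g' := quot_rep _ in Pg' eg *.
have PB a b : P a -> P b -> P (a - b).
  by move=> Pa Pb; rewrite -[a - b]addrC -scaleN1r; exact: PL.
have evB a b : ev (a - b) = ev a - ev b.
  by rewrite addrC -scaleN1r evL scaleN1r addrC.
have zf : ev (f' - f) = 0 by rewrite evB -ef quot_piE // subrr.
have zg : ev (g' - g) = 0 by rewrite evB -eg quot_piE // subrr.
apply/eqP; rewrite (quot_piE (PM Pf Pg)) (quot_piE (PM Pf' Pg')) -subr_eq0 -evB.
have -> : f' * g' - f * g = 1 *: (f' * (g' - g)) + (f' - f) * g.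
  by rewrite scale1r mulrBr mulrBl addrA subrK.
by rewrite evL (ev_ideal (PB _ _ Pg' Pg) Pf' zg).2 (ev_ideal (PB _ _ Pf' Pf) Pg zf).1 scaler0 addr0.
Qed.

Lemma quot_piL c f g : P f -> P g -> quot_pi (c *: f + g) = c *: quot_pi f + quot_pi g.
Proof.
move=> Pf Pg; apply/val_inj; rewrite quot_piE ?evL; last exact: PL.
by rewrite [RHS](linearP (\val : quot -> (I -> K^o))) /= !quot_piE.
Qed.

Let Pr x : P (quot_rep x) := (quot_repP x).1.

Fact quot_mulA : associative quot_mul.
Proof.
move=> x y z; rewrite -(quot_pi_rep x) -(quot_pi_rep y) -(quot_pi_rep z).
by rewrite !quot_piM ?mulrA //; apply: PM.
Qed.

Let PD f g : P f -> P g -> P (f + g).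
Proof. by move=> Pf Pg; rewrite -[f]scale1r; exact: PL. Qed.

Let PZ c f : P f -> P (c *: f).
Proof. by move=> Pf; rewrite -[_ *: _]addr0; exact: PL. Qed.

Let piD f g : P f -> P g -> quot_pi f + quot_pi g = quot_pi (f + g).
Proof. by move=> Pf Pg; rewrite -[f in RHS]scale1r quot_piL // scale1r. Qed.

Let piZ c f : P f -> c *: quot_pi f = quot_pi (c *: f).
Proof.
move=> Pf; rewrite -[c *: f]addr0 quot_piL //.
suff -> : quot_pi 0 = 0 by rewrite addr0.
by apply/val_inj; rewrite quot_piE // ev0 raddf0.
Qed.

Fact quot_mulDl : left_distributive quot_mul +%R.
Proof.
move=> x y z; rewrite -(quot_pi_rep x) -(quot_pi_rep y) -(quot_pi_rep z).
by rewrite piD // !quot_piM ?piD ?mulrDl //; (apply: PM || apply: PD).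
Qed.

Fact quot_mulDr : right_distributive quot_mul +%R.
Proof.
move=> x y z; rewrite -(quot_pi_rep x) -(quot_pi_rep y) -(quot_pi_rep z).
by rewrite piD // !quot_piM ?piD ?mulrDr //; (apply: PM || apply: PD).
Qed.

Fact quot_mulZl (c : K) x y : quot_mul (c *: x) y = c *: quot_mul x y.
Proof.
rewrite -(quot_pi_rep x) -(quot_pi_rep y) piZ // !quot_piM ?piZ ?scalerAl //.
- exact: PM.
- exact: PZ.
Qed.

Fact quot_mulZr (c : K) x y : quot_mul x (c *: y) = c *: quot_mul x y.
Proof.
rewrite -(quot_pi_rep x) -(quot_pi_rep y) piZ // !quot_piM ?piZ ?scalerAr //.
- exact: PM.
- exact: PZ.
Qed.

HB.instance Definition _ := Lmodule_isNuAlgebra.Build K quot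
  quot_mulA quot_mulDl quot_mulDr quot_mulZl quot_mulZr.

(** Interface to the quotient: what follows relies on these five properties and not on the
    construction. *)
Lemma quotient_nualg : exists (A : nuAlgType K) (pi : ncseries K -> A) (e : A -> I -> K^o),
  [/\ injective e, forall f, P f -> e (pi f) = ev f,
      forall x, exists2 f, P f & x = pi f,
      forall c f g, P f -> P g -> pi (c *: f + g) = c *: pi f + pi g &
      forall f g, P f -> P g -> pi (f * g) = pi f ** pi g].
Proof.
exists quot, quot_pi, quot_val; split.
- exact: val_inj.
- exact: quot_piE.
- by move=> x; exists (quot_rep x); rewrite ?quot_pi_rep.
- exact: quot_piL.
- by move=> f g Pf Pg; rewrite -quot_piM.
Qed.

End Quotient.

(** * Linear algebra *)

Lemma nontrivial_solution (K : fieldType) (I : finType) m (v : 'I_m -> I -> K) :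
  (#|I| < m)%N ->
  exists2 c : 'I_m -> K, exists i, c i != 0 & forall k, \sum_i c i * v i k = 0.
Proof.
move=> ltIm; pose M := \matrix_(i < m, k < #|I|) v i (enum_val k).
have : kermx M != 0.
  by rewrite kermx_eq0 -row_leq_rank -ltnNge (leq_ltn_trans (rank_leq_col M)).
case/rowV0Pn => c /sub_kermxP cM cN0; exists (c 0).
  by have /matrix0Pn[i [j cij]] := cN0; exists j; rewrite (ord1 i) in cij.
move=> k; have /matrixP/(_ 0 (enum_rank k)) := cM; rewrite !mxE => e.
by rewrite -[RHS]e; apply: eq_bigr => i _; rewrite mxE enum_rankK.
Qed.

(** Leading terms of distinct degrees cannot cancel: the largest polynomial with a nonzero
    coefficient decides the size. *)
Lemma size_sum_distinct (K : fieldType) m (T : 'I_m -> {poly K}) (c : 'I_m -> K) :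
  (forall i, T i != 0) -> injective (fun i => size (T i)) -> (exists i, c i != 0) ->
  exists2 i, c i != 0 & size (\sum_i c i *: T i) = size (T i).
Proof.
move=> TN0 injT [i0 ci0].
pose i1 := [arg max_(i > i0 | c i != 0) size (T i)].
have [ci1 max1] : c i1 != 0 /\ forall j, c j != 0 -> (size (T j) <= size (T i1))%N.
  by rewrite /i1; case: arg_maxnP.
exists i1 => //; rewrite (bigD1 i1) //= size_polyDl size_scale //.
apply: leq_ltn_trans (size_sum _ _ _) _.
elim/big_ind: _ => [|a b ha hb|j ji]; rewrite ?size_poly_gt0 ?gtn_max ?ha //.
have [->|cj] := eqVneq (c j) 0; first by rewrite scale0r size_poly0 size_poly_gt0.
rewrite size_scale // ltn_neqAle max1 // andbT.
by apply: contra ji => /eqP /injT ->.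
Qed.

Lemma two_solutions (K : fieldType) (I : finType) m (T : 'I_m -> {poly K}) (v : 'I_m -> I -> K) :
  (#|I|.+1 < m)%N -> (forall i, T i != 0) -> injective (fun i => size (T i)) ->
  exists c c' : 'I_m -> K,
    [/\ forall k, \sum_i c i * v i k = 0, forall k, \sum_i c' i * v i k = 0,
        \sum_i c i *: T i != 0, \sum_i c' i *: T i != 0
      & size (\sum_i c i *: T i) != size (\sum_i c' i *: T i)].
Proof.
move=> ltm TN0 injT; have [c cN0 cv] := nontrivial_solution v (ltnW ltm).
have [i1 ci1 szc] := size_sum_distinct TN0 injT cN0.
(* The second solution vanishes at the index that governs the size of the first one. *)
pose v' i (k : option I) := if k is Some k then v i k else (i == i1)%:R.
have [|c' c'N0 c'v] := @nontrivial_solution K (option I) m v'; first by rewrite card_option.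
have [i2 ci2 szc'] := size_sum_distinct TN0 injT c'N0.
have c'i1 : c' i1 = 0.
  have := c'v None; rewrite (bigD1 i1) //= eqxx mulr1 big1 ?addr0 // => i /negPf ->.
  by rewrite mulr0.
exists c, c'; split=> //; rewrite -?size_poly_gt0 ?szc ?szc' ?size_poly_gt0 //.
- by move=> k; have := c'v (Some k).
- by apply/negP => /eqP /injT e; rewrite -e c'i1 eqxx in ci2.
Qed.

(** * Bases and dimension of subspaces *)

Section Dimension.
Context {K : fieldType} {V : lmodType K}.
Implicit Types (W : set V) (x y : V).

Lemma linear_subspaceP W : linear_subspace W <->
  (W 0 /\ forall c x y, W x -> W y -> W (c *: x + y)).
Proof.
split=> [[W0 WL]|[W0 WL]]; split.
- by rewrite inE in W0.
- by move=> c x y Wx Wy; have := WL c x y; rewrite !inE; exact.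
- by rewrite inE.
- by move=> c x y; rewrite !inE; exact: WL.
Qed.

Lemma subspace0 W : linear_subspace W -> W 0.
Proof. by move=> /linear_subspaceP[]. Qed.

Lemma subspaceZ W c x : linear_subspace W -> W x -> W (c *: x).
Proof. by move=> /linear_subspaceP[W0 WL] Wx; rewrite -[_ *: _]addr0; exact: WL. Qed.

Lemma subspaceD W x y : linear_subspace W -> W x -> W y -> W (x + y).
Proof. by move=> /linear_subspaceP[W0 WL] Wx Wy; rewrite -[x]scale1r; exact: WL. Qed.

Lemma subspace_sum W I (r : seq I) (P : pred I) (F : I -> V) : linear_subspace W ->
  (forall i, P i -> W (F i)) -> W (\sum_(i <- r | P i) F i).
Proof.
move=> Wl WF; elim/big_rec: _ => [|i x Pi Wx]; first exact: subspace0.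
by apply: subspaceD => //; exact: WF.
Qed.

Lemma lspan_subspace (S : set V) : linear_subspace (lspan S).
Proof.
apply/linear_subspaceP; split=> [W [Wl _]|c x y Sx Sy W [Wl SW]]; first exact: subspace0.
by apply: subspaceD => //; [apply: subspaceZ => //; apply: Sx | apply: Sy].
Qed.

Lemma sub_lspan (S : set V) : S `<=` lspan S.
Proof. by move=> x Sx W [_]; exact. Qed.

Lemma lspan_min (S W : set V) : linear_subspace W -> S `<=` W -> lspan S `<=` W.
Proof. by move=> Wl SW x; apply. Qed.

Lemma lspan_range m (e : 'I_m -> V) x :
  lspan (range e) x <-> exists c : 'I_m -> K, x = \sum_i c i *: e i.
Proof.
split=> [|[c ->]]; last first.
  apply: (@subspace_sum (lspan (range e)) _ (index_enum 'I_m) xpredT (fun i => c i *: e i)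
    (lspan_subspace _)) => i _.
  by apply: (subspaceZ _ (lspan_subspace _)); apply: sub_lspan; exists i.
suff H : lspan (range e) `<=` [set y | exists c : 'I_m -> K, y = \sum_i c i *: e i] by exact: H.
apply: lspan_min.
  apply/linear_subspaceP; split=> [|a y z [c ->] [d ->]].
    by exists (fun=> 0); rewrite big1 // => i _; rewrite scale0r.
  exists (fun i => a * c i + d i); rewrite scaler_sumr -big_split.
  by apply: eq_bigr => i _; rewrite scalerDl scalerA.
move=> _ [i _ <-]; exists (fun j => (j == i)%:R).
by rewrite (bigD1 i) //= eqxx scale1r big1 ?addr0 // => j /negPf ->; rewrite scale0r.
Qed.

Definition lin_indep m (e : 'I_m -> V) :=
  forall c : 'I_m -> K, \sum_i c i *: e i = 0 -> forall i, c i = 0.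

Lemma lin_indep_lspan m n (e : 'I_m -> V) (f : 'I_n -> V) :
  lin_indep f -> (forall i, lspan (range e) (f i)) -> (n <= m)%N.
Proof.
move=> indf fe; rewrite leqNgt; apply/negP => ltmn.
have /choice[v vE] : forall i, exists c : 'I_m -> K, f i = \sum_k c k *: e k.
  by move=> i; apply/lspan_range.
have [|c [i ci] cv] := @nontrivial_solution K 'I_m n v; first by rewrite card_ord.
suff /indf /(_ i) /eqP : \sum_i c i *: f i = 0 by rewrite (negPf ci).
under eq_bigr => j _ do rewrite vE scaler_sumr.
rewrite exchange_big big1 //= => k _.
by under eq_bigr => j _ do rewrite scalerA; rewrite -scaler_suml cv scale0r.
Qed.

Lemma lin_indep_extend m (e : 'I_m -> V) x : lin_indep e -> ~ lspan (range e) x ->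
  lin_indep (fun i : 'I_m.+1 => if unlift ord0 i is Some j then e j else x).
Proof.
move=> inde nx c; rewrite big_ord_recl unlift_none.
under eq_bigr => i _ do rewrite liftK.
have [c0|c0 s0] := eqVneq (c ord0) 0.
  rewrite c0 scale0r add0r => /inde s0 i; case: (unliftP ord0 i) => [j ->|-> //].
  exact: (s0 j).
case: nx; apply/lspan_range; exists (fun i => - (c ord0)^-1 * c (lift ord0 i)).
apply: (scalerI c0); rewrite scaler_sumr; under eq_bigr => i _ do
  rewrite scalerA mulrA mulrN divff // mulN1r scaleNr.
by rewrite sumrN; apply/eqP; rewrite -addr_eq0 s0.
Qed.

(** [ldim] is chosen by [xget] and is meaningful only once a basis exists. A bound on the
    independent families yields a maximal one, which spans [W] by [lin_indep_extend]. *)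
Lemma ldimP W N : linear_subspace W ->
  (forall m (e : 'I_m -> V), (forall i, W (e i)) -> lin_indep e -> (m <= N)%N) ->
  [/\ finite_dim W, (ldim W <= N)%N
    & forall m (e : 'I_m -> V), (forall i, W (e i)) -> lin_indep e -> (m <= ldim W)%N].
Proof.
move=> Wl bndW.
pose Q m := `[< exists e : 'I_m -> V, (forall i, W (e i)) /\ lin_indep e >].
have exQ : exists m, Q m.
  by exists 0; apply/asboolP; exists (fun=> 0); split=> [[]|c _ []].
have bndQ m : Q m -> (m <= N)%N by move=> /asboolP[e [We inde]]; exact: bndW inde.
have [m /asboolP[e [We inde]] maxm] := ex_maxnP exQ bndQ.
have spanW : lspan (range e) = W.
  apply/seteqP; split; first by apply: lspan_min => // _ [i _ <-].
  move=> x Wx; apply: contrapT => nx.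
  suff /maxm : Q m.+1 by rewrite ltnn.
  apply/asboolP; eexists; split; last exact: (lin_indep_extend inde nx).
  by move=> i /=; case: (unlift ord0 i).
have dimW : has_dim W m by exists e.
have fdW : finite_dim W by exists m.
have [e' [spanW' inde']] : has_dim W (ldim W).
  by rewrite /ldim; case: xgetP => [k _ //|/(_ m)].
split=> //.
  by apply: (bndW _ e') => // i; rewrite -spanW'; apply: sub_lspan; exists i.
by move=> n f Wf indf; apply: (lin_indep_lspan (e := e') indf) => i; rewrite spanW'.
Qed.

End Dimension.

(** * Rational series *)

Section Rational.
Variable K : fieldType.
Implicit Types (f g : ncseries K) (u v w : seq bool).

(** The elements of the free algebra without unit; a degree bound expresses finite support, as there
    are finitely many words of each length. *)
Definition nonunital_poly f := f [::] = 0 /\ exists D, forall w, (D < size w)%N -> f w = 0.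

Lemma nonunital_poly0 : nonunital_poly 0.
Proof. by split=> //; exists 0%N. Qed.

Lemma nonunital_polyL c f g : nonunital_poly f -> nonunital_poly g -> nonunital_poly (c *: f + g).
Proof.
move=> [f0 [D fD]] [g0 [D' gD]]; split; first by rewrite serDE serZE f0 g0 mulr0 addr0.
exists (maxn D D') => w; rewrite gtn_max => /andP[/fD fw /gD gw].
by rewrite serDE serZE fw gw mulr0 addr0.
Qed.

Lemma nonunital_polyM f g : nonunital_poly f -> nonunital_poly g -> nonunital_poly (f * g).
Proof.
move=> [f0 [D fD]] [g0 [D' gD]]; split; first by rewrite serM_nil f0 mul0r.
exists (D + D')%N => w sw; rewrite serME big1 // => i _.
have [le|lt] := leqP i D.
  by rewrite gD ?mulr0 // size_drop; lia.
by rewrite fD ?mul0r // size_takel -1?ltnS.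
Qed.

Lemma nonunital_hom n f : homogeneous n.+1 f -> nonunital_poly f.
Proof.
by move=> hf; split; [rewrite hf | exists n.+1 => w sw; rewrite hf // neq_ltn sw orbT].
Qed.

Lemma nonunital_hcomp n f : nonunital_poly f -> nonunital_poly (hcomp n f).
Proof.
move=> [f0 [D fD]]; split; first by rewrite /hcomp f0 if_same.
by exists D => w /fD fw; rewrite /hcomp fw if_same.
Qed.

Lemma sum_hcomp f D : (forall w, (D < size w)%N -> f w = 0) -> f = \sum_(n < D.+1) hcomp n f.
Proof.
move=> fD; apply/funext => w; rewrite ser_sumE.
have [le|lt] := leqP (size w) D; last first.
  by rewrite fD // big1 // => n _; rewrite /hcomp fD ?if_same.
rewrite (bigD1 (Ordinal (le : (size w < D.+1)%N))) //= /hcomp eqxx big1 ?addr0 // => n.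
by rewrite -val_eqE eq_sym /= => /negPf ->.
Qed.

(** The inverse of 1 + f. If f has no constant term, its k-th power vanishes on words shorter than
    k, so stopping at [size w] loses nothing. *)
Definition geom f : ncseries K := fun w => \sum_(k < (size w).+1) ((- f) ^+ k) w.

Lemma serX_low f k w : f [::] = 0 -> (size w < k)%N -> (f ^+ k) w = 0.
Proof.
move=> f0; elim: k w => // k IHk w sw; rewrite exprS.
by apply: (@serM_low0 _ 1 k) => // -[].
Qed.

Lemma geomE f w N : f [::] = 0 -> (size w < N)%N ->
  geom f w = (\sum_(k < N) (- f) ^+ k) w.
Proof.
move=> f0 ltN; rewrite ser_sumE /geom -!(big_mkord xpredT (fun k => ((- f) ^+ k) w)).
rewrite [RHS](big_cat_nat (n := (size w).+1)) //=.
rewrite [X in _ + X]big_nat [X in _ + X]big1 ?addr0 // => k /andP[lek _].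
by rewrite serX_low // serNE f0 oppr0.
Qed.

Lemma geom_eq f : f [::] = 0 -> geom f + f * geom f = 1.
Proof.
move=> f0; apply/funext => w; set N := (size w).+1.
have geomS v : (size v < N)%N -> geom f v = (\sum_(k < N) (- f) ^+ k) v by exact: geomE.
have -> : (geom f + f * geom f) w = ((1 + f) * \sum_(k < N) (- f) ^+ k) w.
  rewrite mulrDl mul1r !serDE geomS //; congr (_ + _).
  by apply: eq_bigr => i _; rewrite geomS // ltnS size_drop leq_subr.
(* Telescoping: 1 + f times the partial sum is 1 - (-f)^N, and (-f)^N vanishes on w because N
   exceeds its length. *)
have := subrX1 (- f) N; rewrite -opprD mulNr [f + 1]addrC => /(congr1 -%R).
rewrite opprK opprB => <-; rewrite serBE serX_low ?subr0 //.
by rewrite serNE f0 oppr0.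
Qed.

Lemma deriv1D c f g : deriv1 c (f + g) = deriv1 c f + deriv1 c g. Proof. by []. Qed.
Lemma deriv1N c f : deriv1 c (- f) = - deriv1 c f. Proof. by []. Qed.

Lemma deriv1M0 c f g : f [::] = 0 -> deriv1 c (f * g) = deriv1 c f * g.
Proof. by move=> f0; apply/funext => w; rewrite /deriv1 serM_cons f0 mul0r add0r. Qed.

Lemma deriv1_geom c f : f [::] = 0 -> deriv1 c (geom f) = - (deriv1 c f * geom f).
Proof.
move=> f0; have e : geom f = 1 - f * geom f by rewrite -(geom_eq f0) addrK.
rewrite -deriv1M0 // -deriv1N {1}e deriv1D.
by have -> : deriv1 c (1 : ncseries K) = 0 by []; rewrite add0r.
Qed.

Lemma poly_deriv1 c f D : (forall w, (D < size w)%N -> f w = 0) ->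
  deriv1 c f = \sum_(v : {bseq D of bool}) f (c :: v) *: mono K v.
Proof.
move=> fD; apply/funext => w; rewrite ser_sumE /deriv1.
have [lew|ltw] := leqP (size w) D.
  rewrite (bigD1 (Bseq lew)) //= serZE /mono eqxx mulr1 big1 ?addr0 // => v.
  by rewrite serZE eq_sym -val_eqE /= => /negPf ->; rewrite mulr0.
rewrite fD ?(ltnW ltw) ?ltnS 1?ltnW // big1 // => v _; rewrite serZE hom_mono ?mulr0 //.
by rewrite neq_ltn (leq_ltn_trans (size_bseq v) ltw) orbT.
Qed.

(* The span of the series v * geom f, with v a word of length at most D, is stable
   under left derivatives, so that geom f is rational. *)
Lemma geom_derivatives f D : f [::] = 0 -> (forall w, (D < size w)%N -> f w = 0) ->
  forall u, exists m : {bseq D of bool} -> {bseq D of bool} -> K,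
  forall (a : {bseq D of bool}) w,
    (mono K a * geom f) (u ++ w) = \sum_b m a b * (mono K b * geom f) w.
Proof.
move=> f0 fD; pose F (a : {bseq D of bool}) := mono K a * geom f.
have step c (a : {bseq D of bool}) : exists m : {bseq D of bool} -> K,
    deriv1 c (F a) = \sum_b m b *: F b.
  case: a => [[|c' v] szv] /=.
    exists (fun b => - f (c :: b)); rewrite {1}/F /= [mono K _ * _]mul1r deriv1_geom //.
    rewrite (poly_deriv1 _ fD) mulr_suml -sumrN; apply: eq_bigr => b _.
    by rewrite -scalerAl scaleNr.
  pose b0 : {bseq D of bool} := Bseq (ltnW szv); exists (fun b => ((c == c') && (b == b0))%:R).
  rewrite /F /= deriv1M0 // (bigD1 b0) //= eqxx andbT big1 ?addr0; last first.
    by move=> b /negPf ->; rewrite andbF scale0r.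
  rewrite scalerAl; congr (_ * _); apply/funext => w.
  by rewrite serZE /deriv1 /mono eqseq_cons -natrM mulnb.
elim=> [|c u [m mE]].
  exists (fun a b => (a == b)%:R) => a w; rewrite (bigD1 a) //= eqxx mul1r big1 ?addr0 //.
  by move=> b; rewrite eq_sym => /negPf ->; rewrite mul0r.
have /choice[m1 m1E] : forall a, exists m1 : {bseq D of bool} -> K,
  deriv1 c (F a) = \sum_b m1 b *: F b by exact: step.
exists (fun a b => \sum_d m1 a d * m d b) => a w.
have -> : (mono K a * geom f) ((c :: u) ++ w) = deriv1 c (F a) (u ++ w) by [].
rewrite m1E ser_sumE; under eq_bigr => d _ do rewrite serZE /F mE mulr_sumr.
by rewrite exchange_big; apply: eq_bigr => b _; rewrite mulr_suml; apply: eq_bigr => d _; rewrite mulrA.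
Qed.

(** Left derivatives along u, then along w, multiply a finite family by matrices depending on u and
    on w alone. The entries [m w a b] thus span, as functions of w, all the series w |-> geom f (u w
    v). *)
Lemma geom_rational f : nonunital_poly f -> exists (I : finType) (e : I -> ncseries K),
  forall u v, exists c : I -> K, forall w, geom f (u ++ w ++ v) = \sum_i c i * e i w.
Proof.
move=> [f0 [D fD]]; have /choice[m mE] := geom_derivatives f0 fD.
exists ({bseq D of bool} * {bseq D of bool})%type, (fun i w => m w i.1 i.2) => u v.
exists (fun i : {bseq D of bool} * {bseq D of bool} =>
  m u (@Bseq D bool [::] (leq0n D)) i.1 * (mono K i.2 * geom f) v) => w.
have -> : geom f (u ++ w ++ v) = (mono K (@Bseq D bool [::] (leq0n D)) * geom f) (u ++ w ++ v).
  by rewrite /= [mono K _ * _]mul1r.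
rewrite mE -(pair_bigA _ (fun a b : {bseq D of bool} =>
  m u (@Bseq D bool [::] (leq0n D)) a * (mono K b * geom f) v * m w a b)).
apply: eq_bigr => a _ /=; rewrite mE mulr_sumr; apply: eq_bigr => b _.
by rewrite -mulrA; congr (_ * _); rewrite mulrC.
Qed.

End Rational.

(** * Enumeration of the free algebra over a countable field *)

Section Enumeration.
Variable K : countFieldType.

(** A code is a degree bound with finitely many coefficients, so there are countably many codes. The
    constant term is forced to 0, which makes every code valid. *)
Definition poly_of_code (s : {D : nat & {ffun {bseq D of bool} -> K}}) : ncseries K :=
  fun w => if w is [::] then 0 else oapp (tagged s) 0 (insub w).

Definition nth_poly (j : nat) : ncseries K := oapp poly_of_code 0 (choice.unpickle j).

Lemma nth_poly_nonunital j : nonunital_poly (nth_poly j).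
Proof.
rewrite /nth_poly; case: choice.unpickle => [[D g]|] /=; last by split=> //; exists 0%N.
by split=> //; exists D => -[|c w] // ltD; rewrite /poly_of_code insubF // leqNgt ltD.
Qed.

Lemma nth_poly_surj f : nonunital_poly f -> exists j, nth_poly j = f.
Proof.
move=> [f0 [D fD]]; pose g : {ffun {bseq D of bool} -> K} := [ffun v : {bseq D of bool} => f v].
exists (choice.pickle (existT (fun D => {ffun {bseq D of bool} -> K}) D g)).
rewrite /nth_poly choice.pickleK /=; apply/funext => -[|c w]; first by rewrite f0.
rewrite /poly_of_code; case: insubP => [v _ <- /=|]; first by rewrite ffunE.
by rewrite -ltnNge => /fD ->.
Qed.

End Enumeration.

(** * Existence of the functionals p_j and q_j *)

Section Tiles.
Variable K : fieldType.
Implicit Types (f g : ncseries K) (u v w y : seq bool) (l m n : nat) (B : bool -> ncseries K).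

(* With a = false and b = true, the coefficient of 'X^n in [tile w] is that of w in
   (a + b b) ^ n. *)
Fixpoint tile w : {poly K} :=
  match w with
  | [::] => 1
  | false :: w => 'X * tile w
  | true :: true :: w => 'X * tile w
  | _ => 0
  end.

(** [tile] is not multiplicative, since a tile b b may straddle the cut between two words. For the
    words in the support of a tame series this does no harm, and [symbol] becomes multiplicative
    ([symbolM]). *)
Definition tame f := forall w v, f w != 0 -> tile (w ++ v) = tile w * tile v.

(** Its coefficient of degree N is the pairing of [f], in degree [n], with (a + b b)^N. *)
Definition symbol n f : {poly K} := wsum n (fun w => f w *: tile w).

Lemma symbolM m n f g : homogeneous m f -> tame f -> symbol (m + n) (f * g) = symbol m f * symbol n g.
Proof.
move=> hf tf; rewrite /symbol wsum_cat -wsumMr; apply: eq_wsum => u su.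
rewrite -wsumMl; apply: eq_wsum => v sv; rewrite (hom_catE _ _ hf) //.
have [->|fu] := eqVneq (f u) 0; first by rewrite mul0r !scale0r mul0r.
by rewrite (tf _ _ fu) -scalerAl -scalerAr scalerA.
Qed.

Lemma symbol_sum n I (r : seq I) (P : pred I) (c : I -> K) (F : I -> ncseries K) :
  symbol n (\sum_(i <- r | P i) c i *: F i) = \sum_(i <- r | P i) c i *: symbol n (F i).
Proof.
have symD g h : symbol n (g + h) = symbol n g + symbol n h.
  by rewrite /symbol -wsumD; apply: eq_wsum => w _; rewrite scalerDl.
have sym0 : symbol n 0 = 0 by apply: wsum_eq0 => w _; rewrite scale0r.
elim/big_rec2: _ => // i y1 y2 _ <-; rewrite symD; congr (_ + _).
rewrite /symbol (wsum_add ( *:%R (c i))); apply: eq_wsum => w _.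
by rewrite /= scalerA.
Qed.

Lemma tameM m f g : homogeneous m f -> tame f -> tame g -> tame (f * g).
Proof.
move=> hf tf tg w v; have [lew|ltw] := leqP m (size w); last first.
  by rewrite (@serM_low0 _ m 0) ?addn0 ?eqxx // => x sx; rewrite hf // neq_ltn sx.
rewrite -(cat_take_drop m w) (hom_catE _ _ hf) ?size_takel // mulf_eq0 negb_or => /andP[fu gu].
by rewrite -catA (tf _ _ fu) (tg _ _ gu) (tf _ _ fu) mulrA.
Qed.

Lemma tame_sum I (r : seq I) (c : I -> K) (F : I -> ncseries K) :
  (forall i, tame (F i)) -> tame (\sum_(i <- r) c i *: F i).
Proof.
move=> tF w v; rewrite ser_sumE => sN0.
suff [i Fi] : exists i, F i w != 0 by exact: tF Fi.
apply: contrapT => H; move/negP: sN0; apply; apply/eqP; apply: big1 => i _; rewrite serZE.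
have [->|Fi] := eqVneq (F i w) 0; first by rewrite mulr0.
by case: H; exists i.
Qed.

Lemma tame1 : tame 1.
Proof. by move=> [|c w] v; rewrite ?mul1r // ser1E eqxx. Qed.

Definition bprod B y : ncseries K := \prod_(b <- y) B b.

Lemma bprod_nil B : bprod B [::] = 1.
Proof. by rewrite /bprod big_nil. Qed.

Lemma bprod_cons B b y : bprod B (b :: y) = B b * bprod B y.
Proof. by rewrite /bprod big_cons. Qed.

Lemma bprod_cat B y z : bprod B (y ++ z) = bprod B y * bprod B z.
Proof. by rewrite /bprod big_cat. Qed.

Lemma hom_bprod l B y : (forall b, homogeneous l (B b)) -> homogeneous (size y * l) (bprod B y).
Proof. exact: hom_prod. Qed.

(* With p = B false and q = B true, this is the block word p ^ r E p ^ n q ^ (M - n). *)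
Definition zword (r : nat) (E : seq bool) (M n : nat) : seq bool :=
  nseq r false ++ E ++ nseq n false ++ nseq (M - n) true.

Lemma size_zword r E M n : (n <= M)%N -> size (zword r E M n) = (r + size E + M)%N.
Proof. by move=> le; rewrite !size_cat !size_nseq; lia. Qed.

(* The sizes of the symbols keep p and q linearly independent, and the nonvanishing
   symbols keep a + b b from becoming nilpotent. *)
Definition good_pair l B := [/\ (0 < l)%N, forall b, homogeneous l (B b), forall b, tame (B b),
  forall b, symbol l (B b) != 0 & size (symbol l (B false)) != size (symbol l (B true))].

Lemma tame_bprod l B y : good_pair l B -> tame (bprod B y).
Proof.
move=> [_ hB tB _ _]; elim: y => [|b y IHy]; first by rewrite bprod_nil; exact: tame1.
by rewrite bprod_cons; apply: tameM (hB b) (tB b) IHy.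
Qed.

Lemma symbol_bprod l B y : good_pair l B ->
  symbol (size y * l) (bprod B y) = \prod_(b <- y) symbol l (B b).
Proof.
move=> [_ hB tB _ _]; elim: y => [|b y IHy].
  by rewrite bprod_nil big_nil /symbol /= ser1E scale1r.
by rewrite bprod_cons mulSn symbolM // IHy big_cons.
Qed.

Lemma size_symbol_bprod l B y : good_pair l B ->
  size (symbol (size y * l) (bprod B y)) =
  (count negb y * (size (symbol l (B false))).-1 + count id y * (size (symbol l (B true))).-1).+1.
Proof.
move=> gB; have [_ _ _ sN0 _] := gB; rewrite symbol_bprod //.
elim: y => [|b y IHy]; first by rewrite big_nil size_poly1.
rewrite big_cons size_mul // ?IHy /=; last first.
  by rewrite -size_poly_gt0 IHy.
have -> : size (symbol l (B b)) = (size (symbol l (B b))).-1.+1 by rewrite prednK // size_poly_gt0.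
case: b; rewrite /= ?add0n ?add1n ?mulSn.
  by move: (size _).-1 (_ * _)%N (_ * _)%N => A x y'; lia.
by move: (size (symbol l (B false))).-1 (_ * _)%N (_ * _)%N => A x y'; lia.
Qed.

(** The symbols of p and q have different degrees, hence so do those of the M + 1 block words, which
    differ in the proportion of p and q. As [#|I| < M], [two_solutions] has one equation to spare
    for separating the two new symbols. *)
Lemma good_pair_step l B r E M (I : finType) (e : I -> ncseries K) :
  good_pair l B -> (#|I| < M)%N ->
  exists C : bool -> nat -> K,
    let B' b := \sum_(n < M.+1) C b n *: bprod B (zword r E M n) in
    let l' := ((r + size E + M) * l)%N in
    good_pair l' B' /\ forall b i, pairing l' (B' b) (e i) = 0.
Proof.
move=> gB ltM; have [l0 hB tB sN0 neqs] := gB; set l' := ((r + size E + M) * l)%N.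
pose F n := bprod B (zword r E M n).
have szz (n : 'I_M.+1) : size (zword r E M n) = (r + size E + M)%N by rewrite size_zword -1?ltnS.
have szF (n : 'I_M.+1) := size_symbol_bprod (zword r E M n) gB.
have FN0 (n : 'I_M.+1) : symbol l' (F n) != 0.
  by rewrite -size_poly_gt0 /l' -(szz n) szF.
have injF : injective (fun n : 'I_M.+1 => size (symbol l' (F n))).
  move=> n n'; rewrite /l' -[in LHS](szz n) -[in RHS](szz n') !szF /zword !count_cat !count_nseq /=.
  rewrite !mul0n !mul1n !addn0 !add0n => -[] e1; apply/val_inj => /=.
  have := sN0 false; have := sN0 true; rewrite -!size_poly_gt0.
  move: neqs e1 (ltn_ord n) (ltn_ord n'); rewrite !ltnS.
  set a := size _; set b := size _; move: (nat_of_ord n) (nat_of_ord n') => {FN0 szF szz} n1 n2.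
  (* Writing M = n1 + m1 = n2 + m2 removes the truncated subtractions; equality of the degrees then
     amounts to (a - b) (n1 - n2) = 0. *)
  move=> ab e1 n1M n2M b0 a0; have [m1 e1m] : exists m, M = (n1 + m)%N by exists (M - n1)%N; lia.
  have [m2 e2m] : exists m, M = (n2 + m)%N by exists (M - n2)%N; lia.
  have s1 : (M - n1 = m1)%N by lia.
  have s2 : (M - n2 = m2)%N by lia.
  move: e1; rewrite s1 s2; nia.
have [c [c' [cv c'v cN0 c'N0 ncc']]] :=
  two_solutions (fun (n : 'I_M.+1) i => pairing l' (F n) (e i)) ltM FN0 injF.
pose C (b : bool) n := if b then c (inord n) else c' (inord n).
have CE b : \sum_(n < M.+1) C b n *: F n = \sum_(n < M.+1) (if b then c n else c' n) *: F n.
  by apply: eq_bigr => n _; rewrite /C inord_val.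
exists C => B'; have {}CE b : B' b = _ := CE b.
split; last first.
  move=> b i; rewrite CE pairing_suml -[RHS](if b return (if b then _ else _) = _ then cv i else c'v i).
  by case: b; apply: eq_bigr => n _; rewrite pairingZl.
split.
- by rewrite muln_gt0 l0 andbT addn_gt0 (leq_ltn_trans _ ltM) ?orbT.
- move=> b; apply: hom_sum => n _; apply: homZ; rewrite /l' -(szz n); exact: hom_bprod.
- by move=> b; apply: tame_sum => n; exact: tame_bprod gB.
- by case; rewrite CE symbol_sum.
- by rewrite !CE !symbol_sum eq_sym.
Qed.

(** The symbols are the square of the variable for aa and the variable itself for bb, hence of
    different sizes. *)
Lemma good_pair0 : good_pair 2 (fun b => mono K [:: b; b]).
Proof.
have sE b : symbol 2 (mono K [:: b; b]) = if b then 'X else 'X * 'X.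
  by case: b; rewrite /symbol /= /mono /= !scale0r !scale1r ?add0r ?addr0 !mulr1.
split=> //.
- by move=> b; exact: (hom_mono [:: b; b]).
- move=> b w v; rewrite /mono; have [->|//] := eqVneq w [:: b; b]; last by rewrite eqxx.
  by case: b => /= _; rewrite ?mulr1 ?mulrA.
- by case; rewrite sE ?mulf_neq0 ?polyX_eq0.
- by rewrite !sE -expr2 size_polyXn size_polyX.
Qed.

(** [r] takes [l j] as an argument because the number of repetitions has to be large against the
    length already reached. The functionals [e j] to be killed are prescribed in advance, and their
    number bounds [M j] from below. *)
Theorem tower_exists (I : nat -> finType) (e : forall j, I j -> ncseries K)
    (E : nat -> seq bool) (M : nat -> nat) (r : nat -> nat -> nat) :
  (forall j, (#|I j| < M j)%N) ->
  exists (l : nat -> nat) (B : nat -> bool -> ncseries K) (C : nat -> bool -> nat -> K),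
    [/\ l 0%N = 2%N /\ (forall j, l j.+1 = ((r j (l j) + size (E j) + M j) * l j)%N),
        forall b, B 0%N b = mono K [:: b; b],
        forall j, good_pair (l j) (B j),
        forall j b, B j.+1 b =
          \sum_(n < (M j).+1) C j b n *: bprod (B j) (zword (r j (l j)) (E j) (M j) n)
      & forall j b i, pairing (l j.+1) (B j.+1 b) (e j i) = 0].
Proof.
move=> ltM.
(* The state carries its proof of [good_pair], on which the next step depends. *)
pose st := {s : nat * (bool -> ncseries K) | good_pair s.1 s.2}.
have step (j : nat) (s : st) : {s' : st | exists C : bool -> nat -> K,
    let l := (sval s).1 in let B := (sval s).2 in let l' := (sval s').1 in
    [/\ l' = ((r j l + size (E j) + M j) * l)%N,
    forall b, (sval s').2 b = \sum_(n < (M j).+1) C b n *: bprod B (zword (r j l) (E j) (M j) n)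
    & forall b i, pairing l' ((sval s').2 b) (e j i) = 0]}.
  case: s => -[l B] /= gB; apply: cid.
  have [C /= [gB' kB']] := good_pair_step (r j l) (E j) (e j) gB (ltM j).
  by exists (exist _ (_, _) gB'), C.
pose s := nat_rect (fun=> st) (exist _ (2%N, fun b => mono K [:: b; b]) good_pair0)
  (fun j s => sval (step j s)).
have /choice[C CP] := fun j => svalP (step j (s j)).
exists (fun j => (sval (s j)).1), (fun j => (sval (s j)).2), C; split=> //.
- by split=> // j; have [] := CP j.
- by move=> j; exact: (svalP (s j)).
- by move=> j b; have [_ ->] := CP j.
- by move=> j b i; have [_ _ ->] := CP j.
Qed.

End Tiles.

(** * Ranks and codimensions *)

Section CutRank.
Variable K : fieldType.
Implicit Types (f g : ncseries K) (u v w x : seq bool).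

(* Cutting a block at a fixed place yields at most d functionals on either side: the
   incomplete blocks at both ends of a window contribute a factor d ^ 2 only. *)
Definition cutrank (d : nat) f := forall t, exists al be : nat -> seq bool -> K,
  forall u w, size u = t -> f (u ++ w) = \sum_(k < d) al k u * be k w.

Lemma cutrank_mono_word x : cutrank 1 (mono K x).
Proof.
move=> t; exists (fun _ u => (u == take t x)%:R), (fun _ w => (w == drop t x)%:R) => u w su.
rewrite big_ord1 -natrM mulnb /mono; congr (_%:R); congr nat_of_bool.
have [le|lt] := leqP t (size x).
  by rewrite -{1}(cat_take_drop t x) eqseq_cat // size_takel.
have ne : (u == take t x) = false.
  apply/negbTE/eqP => /(congr1 size); rewrite su size_take ltnNge (ltnW lt) /= => e.
  by rewrite e ltnn in lt.
rewrite ne /=; apply/negbTE/eqP => /(congr1 size); rewrite size_cat su => e.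
by move: lt; rewrite -e ltnNge leq_addr.
Qed.

Lemma cutrank0 d : cutrank d 0.
Proof.
move=> t; exists (fun _ _ => 0), (fun _ _ => 0) => u w _.
by rewrite ser0E big1 // => k _; rewrite mul0r.
Qed.

Lemma cutrankZD d1 d2 c f g : cutrank d1 f -> cutrank d2 g -> cutrank (d1 + d2) (c *: f + g).
Proof.
move=> cf cg t; have [al1 [be1 e1]] := cf t; have [al2 [be2 e2]] := cg t.
exists (fun k u => if (k < d1)%N then c * al1 k u else al2 (k - d1)%N u),
  (fun k w => if (k < d1)%N then be1 k w else be2 (k - d1)%N w) => u w su.
rewrite serDE serZE (e1 _ _ su) (e2 _ _ su) big_split_ord /= mulr_sumr; congr (_ + _).
  by apply: eq_bigr => k _; rewrite ltn_ord mulrA.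
by apply: eq_bigr => k _; rewrite ltnNge leq_addr /= addKn.
Qed.

Lemma cutrank_leq d1 d2 f : (d1 <= d2)%N -> cutrank d1 f -> cutrank d2 f.
Proof.
move=> /subnKC <- cf; rewrite -[f]addr0 -[f]scale1r; apply: cutrankZD => //.
exact: cutrank0.
Qed.

Lemma cutrank_sum d m (c : nat -> K) (F : nat -> ncseries K) :
  (forall i, cutrank d (F i)) -> cutrank (m * d) (\sum_(i < m) c i *: F i).
Proof.
move=> cF; elim: m => [|m IHm]; first by rewrite big_ord0; exact: cutrank0.
by rewrite big_ord_recr /= addrC mulSn; exact: cutrankZD.
Qed.

(** The cut falls in one of the two factors and the other one passes entirely to one side, so the
    ranks do not multiply. *)
Lemma cutrankM d l f g : homogeneous l f -> cutrank d f -> cutrank d g -> cutrank d (f * g).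
Proof.
move=> hf cf cg t; have [let_|ltt] := leqP t l.
  have [al [be e]] := cf t.
  exists al, (fun k w => be k (take (l - t) w) * g (drop (l - t) w)) => u w su.
  transitivity (f (u ++ take (l - t) w) * g (drop (l - t) w)); last first.
    by rewrite (e _ _ su) mulr_suml; apply: eq_bigr => k _; rewrite mulrA.
  rewrite -{1}(cat_take_drop (l - t) w) catA.
  have [lew|ltw] := leqP (l - t) (size w).
    by rewrite (hom_catE _ _ hf) // size_cat su size_takel // subnKC.
  rewrite (take_oversize (ltnW ltw)) (drop_oversize (ltnW ltw)) cats0.
  have ltl : (size (u ++ w) < l)%N by rewrite size_cat su; lia.
  rewrite hf ?neq_ltn ?ltl // mul0r (@serM_low0 _ l 0) ?addn0 // => x sx.
  by rewrite hf // neq_ltn sx.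
have [al [be e]] := cg (t - l)%N.
exists (fun k u => f (take l u) * al k (drop l u)), be => u w su.
rewrite -{1}(cat_take_drop l u) -catA (hom_catE _ _ hf); last by rewrite size_takel // su ltnW.
rewrite e ?size_drop ?su // mulr_sumr; apply: eq_bigr => k _.
by rewrite mulrA.
Qed.

(** Codimension counted by linear conditions that suffice to force [P], which avoids forming
    quotient spaces. *)
Definition codim_le (P : ncseries K -> Prop) (N : nat) :=
  exists (I : finType) (th : I -> ncseries K -> K),
  [/\ (#|I| <= N)%N, forall k c f g, th k (c *: f + g) = c * th k f + th k g
    & forall f, (forall k, th k f = 0) -> P f].

Lemma codim_le_sub (P Q : ncseries K -> Prop) N N' :
  (forall f, P f -> Q f) -> (N <= N')%N -> codim_le P N -> codim_le Q N'.
Proof.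
move=> PQ leN [I [th [cI thL thP]]]; exists I, th; split=> //; first exact: leq_trans leN.
by move=> f /thP /PQ.
Qed.

Lemma codim_le0 (P : ncseries K -> Prop) N : (forall f, P f) -> codim_le P N.
Proof. by move=> Pt; exists void, (fun v : void => match v with end); split=> //; rewrite card_void. Qed.

Lemma codim_leI (P Q : ncseries K -> Prop) N N' :
  codim_le P N -> codim_le Q N' -> codim_le (fun f => P f /\ Q f) (N + N').
Proof.
move=> [I [th [cI thL thP]]] [J [ph [cJ phL phQ]]].
exists (I + J)%type, (fun k => match k with inl i => th i | inr i => ph i end); split.
- by rewrite card_sum leq_add.
- by move=> [k|k] c f g; [exact: thL | exact: phL].
- by move=> f H; split; [apply: thP => k; exact: (H (inl k)) | apply: phQ => k; exact: (H (inr k))].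
Qed.

Lemma codim_le_forall n (P : nat -> ncseries K -> Prop) (N : nat -> nat) :
  (forall i, (i < n)%N -> codim_le (P i) (N i)) ->
  codim_le (fun f => forall i, (i < n)%N -> P i f) (\sum_(i < n) N i).
Proof.
elim: n => [|n IHn] H; first exact: codim_le0.
rewrite big_ord_recr /=; have H1 := codim_leI (IHn (fun i lt => H i (ltnW lt))) (H n (leqnn _)).
apply: codim_le_sub H1 => // f [Pf Pn] i; rewrite ltnS leq_eqVlt => /orP[/eqP -> //|].
exact: Pf.
Qed.

Lemma codim_le_forall_const n (P : nat -> ncseries K -> Prop) N :
  (forall i, (i < n)%N -> codim_le (P i) N) ->
  codim_le (fun f => forall i, (i < n)%N -> P i f) (n * N).
Proof. by move=> /codim_le_forall; rewrite sum_nat_const card_ord. Qed.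

End CutRank.

(** * The ideal of a tower of functionals *)

Section Tower.
Variables (K : fieldType) (l : nat -> nat) (B : nat -> bool -> ncseries K)
  (C : nat -> bool -> nat -> K) (r : nat -> nat) (E : nat -> seq bool) (M : nat -> nat).
Hypothesis l0 : l 0 = 2%N.
Hypothesis lS : forall j, l j.+1 = ((r j + size (E j) + M j) * l j)%N.
Hypothesis gB : forall j, good_pair (l j) (B j).
Hypothesis BS : forall j b, B j.+1 b =
  \sum_(n < (M j).+1) C j b n *: bprod (B j) (zword (r j) (E j) (M j) n).
Hypothesis r_gt1 : forall j, (1 < r j)%N.
Implicit Types (f g T : ncseries K) (u v w y z : seq bool) (i j m n k : nat).

Lemma l_gt0 j : (0 < l j)%N. Proof. by have [] := gB j. Qed.

Lemma homB j b : homogeneous (l j) (B j b). Proof. by have [] := gB j. Qed.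

Lemma hom_bprodB j y : homogeneous (size y * l j) (bprod (B j) y).
Proof. by apply: hom_bprod => b; exact: homB. Qed.

Lemma B_neq0 j b : B j b != 0.
Proof.
have [_ _ _ /(_ b) sN0 _] := gB j; apply: contra sN0 => /eqP ->.
by rewrite /symbol; apply/eqP/wsum_eq0 => w _; rewrite ser0E scale0r.
Qed.

Lemma bprod_neq0 j y : bprod (B j) y != 0.
Proof.
elim: y => [|b y IHy]; first by rewrite bprod_nil oner_eq0.
by rewrite bprod_cons (hom_mul_neq0 (@homB j b)) ?B_neq0.
Qed.

Lemma leq_l i j : (i <= j)%N -> (l i <= l j)%N.
Proof.
elim: j => [|j IHj]; first by rewrite leqn0 => /eqP ->.
rewrite leq_eqVlt => /orP[/eqP -> //|/IHj H]; apply: leq_trans H _.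
by rewrite lS leq_pmull //; have := r_gt1 j; lia.
Qed.

Lemma ltn_l i : (i < l i)%N.
Proof.
elim: i => [|i IHi]; first by rewrite l0.
by rewrite lS; have := r_gt1 i; have := l_gt0 i; nia.
Qed.

(* The kernel of [ev] is the ideal defining the algebra. *)
Definition ev f (s : nat * nat * seq bool * seq bool) : K^o :=
  let: (j, n, u, v) := s in wsum n (fun w => B j false (u ++ w ++ v) * f w).

Arguments ev : simpl never.

Lemma evL c f g : ev (c *: f + g) = c *: ev f + ev g.
Proof.
apply/funext => -[[[j n] u] v]; rewrite /ev.
transitivity (c * wsum n (fun w => B j false (u ++ w ++ v) * f w) +
  wsum n (fun w => B j false (u ++ w ++ v) * g w)); last by [].
rewrite -wsumMl -wsumD; apply: eq_wsum => w _.
by rewrite serDE serZE mulrDr mulrCA.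
Qed.

Lemma ev_sum I (s : seq I) (c : I -> K) (F : I -> ncseries K) x :
  ev (\sum_(i <- s) c i *: F i) x = \sum_(i <- s) c i * ev (F i) x.
Proof.
elim: s => [|i s IHs]; last by rewrite !big_cons evL -IHs.
rewrite !big_nil; case: x => [[[j n] u] v]; apply: wsum_eq0 => w _.
by rewrite ser0E mulr0.
Qed.

(** The letters read by g move into the right context, so [ev (f * g)] is a combination of values of
    [ev f]. With [evMr] for the other side, the kernel of [ev] is a two-sided ideal. *)
Lemma evMl f g j n u v : ev (f * g) (j, n, u, v) =
  \sum_(i < n.+1) wsum (n - i) (fun w => g w * ev f (j, val i, u, w ++ v)).
Proof.
rewrite /ev; under eq_wsum => w sw do rewrite serME sw mulr_sumr.
rewrite wsum_big; apply: eq_bigr => i _.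
rewrite -{1}(@subnKC i n) -1?ltnS // wsum_cat wsum_exchange; apply: eq_wsum => w sw.
rewrite -wsumMl; apply: eq_wsum => x sx.
by rewrite take_size_cat // drop_size_cat // -catA mulrA mulrC.
Qed.

Lemma evMr f g j n u v : ev (g * f) (j, n, u, v) =
  \sum_(i < n.+1) wsum i (fun w => g w * ev f (j, (n - i)%N, u ++ w, v)).
Proof.
rewrite /ev; under eq_wsum => w sw do rewrite serME sw mulr_sumr.
rewrite wsum_big; apply: eq_bigr => i _.
rewrite -{1}(@subnKC i n) -1?ltnS // wsum_cat; apply: eq_wsum => w sw.
rewrite -wsumMl; apply: eq_wsum => x sx.
by rewrite take_size_cat // drop_size_cat // -!catA mulrCA.
Qed.

Lemma ev_ideal f g : ev f = 0 -> ev (f * g) = 0 /\ ev (g * f) = 0.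
Proof.
move=> f0; split; apply/funext => -[[[j n] u] v].
  rewrite evMl big1 // => i _; apply: wsum_eq0 => w _; rewrite f0.
  exact: mulr0.
rewrite evMr big1 // => i _; apply: wsum_eq0 => w _; rewrite f0.
exact: mulr0.
Qed.

Lemma ev_factor j a n c X Y W f u v : B j false = X * Y * W ->
  homogeneous a X -> homogeneous n Y -> homogeneous c W -> size u = a -> size v = c ->
  ev f (j, n, u, v) = X u * W v * pairing n Y f.
Proof.
move=> e hX hY hW su sv; rewrite /ev /pairing -wsumMl; apply: eq_wsum => w sw.
rewrite e catA (hom_catE _ _ (homM hX hY)) ?size_cat ?su ?sw //.
by rewrite (hom_catE _ _ hX) // mulrA; congr (_ * _); rewrite mulrAC.
Qed.

Lemma ev_hom0 j n m u v f : homogeneous m f -> n != m -> ev f (j, n, u, v) = 0.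
Proof. by move=> hf nm; apply: wsum_eq0 => w sw; rewrite hf ?mulr0 // sw. Qed.

(** * The prefix p_j p_j of p_{j+1} and survival of products *)

Definition tail_part j b : ncseries K := bprod (B j) (E j) *
  \sum_(n < (M j).+1) C j b n *: bprod (B j) (nseq n false ++ nseq (M j - n) true).

Lemma BSE j b : B j.+1 b = B j false ^+ r j * tail_part j b.
Proof.
rewrite BS /tail_part mulrA mulr_sumr; apply: eq_bigr => n _.
rewrite -scalerAr /zword !bprod_cat -!mulrA; congr (_ *: (_ * _)).
by rewrite /bprod big_nseq; elim: (r j) => //= k ->; rewrite exprS.
Qed.

Lemma hom_tail j b : homogeneous ((size (E j) + M j) * l j) (tail_part j b).
Proof.
rewrite mulnDl; apply: homM; first exact: hom_bprodB.
apply: hom_sum => n _; apply: homZ.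
have := @hom_bprodB j (nseq n false ++ nseq (M j - n) true).
by rewrite size_cat !size_nseq subnKC // -ltnS.
Qed.

Lemma tail_neq0 j b : tail_part j b != 0.
Proof. by have := B_neq0 j.+1 b; rewrite BSE; apply: contra => /eqP ->; rewrite mulr0. Qed.

Lemma BS_prefix j : exists2 W, B j.+1 false = B j false * B j false * W &
  homogeneous (l j.+1 - (l j + l j)) W /\ W != 0.
Proof.
have [k rk] : exists k, r j = k.+2 by exists (r j - 2)%N; have := r_gt1 j; lia.
exists (B j false ^+ k * tail_part j false); first by rewrite BSE rk !exprS !mulrA.
have BX : B j false ^+ k = bprod (B j) (nseq k false).
  by rewrite /bprod big_nseq; elim: k {rk} => //= k IHk; rewrite exprS IHk.
have hX : homogeneous (k * l j) (B j false ^+ k).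
  by rewrite BX -{1}(size_nseq k false); exact: hom_bprodB.
split; last by rewrite (hom_mul_neq0 hX) ?tail_neq0 // BX bprod_neq0.
have -> : (l j.+1 - (l j + l j) = k * l j + (size (E j) + M j) * l j)%N.
  by rewrite lS rk !mulnDl !mulSn; lia.
by apply: homM; [exact: hX | exact: hom_tail].
Qed.

Lemma ev_neq0_size f j n u v : ev f (j, n, u, v) != 0 -> (size u + n + size v)%N = l j.
Proof.
case/wsum_neq0 => w sw; rewrite mulf_eq0 negb_or => /andP[pw _].
by rewrite -(hom_neq0 (@homB j false) pw) !size_cat sw addnA.
Qed.

(** p_{j+1} is p_j times p_j W, and a word on which the second factor does not vanish prolongs the
    right context. So what survives at one stage survives at all later ones. *)
Lemma ev_lift f j n u v : ev f (j, n, u, v) != 0 -> exists v', ev f (j.+1, n, u, v') != 0.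
Proof.
move=> fN0; have szs := ev_neq0_size fN0; have [W e [_ WN0]] := BS_prefix j.
have [w Ww] := ser_neq0 (hom_mul_neq0 (@homB j false) (B_neq0 j false) WN0).
exists (v ++ w); rewrite /ev.
rewrite (eq_wsum (G := fun x => B j false (u ++ x ++ v) * f x * (B j false * W) w)).
  by rewrite wsumMr mulf_neq0.
move=> x sx; rewrite e -mulrA !catA -catA catA (hom_catE _ _ (@homB j false)); last first.
  by rewrite !size_cat -szs sx.
by rewrite -catA mulrAC.
Qed.

Lemma ev_lift_le f i j n u v : (i <= j)%N -> ev f (i, n, u, v) != 0 ->
  exists v', ev f (j, n, u, v') != 0.
Proof.
move=> /subnKC <-; elim: (j - i)%N => [|d IHd] fN0; first by exists v; rewrite addn0.
by have [v' /ev_lift] := IHd fN0; rewrite addnS.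
Qed.

(** Both elements are lifted to a common stage k. The word z joins the right context of f to the
    left context of g, so that the two windows fall into the two leading copies of p_k in p_{k+1};
    the degree bounds leave only the lowest components of f and g. *)
Lemma ev_prime f g i j m n u v u' v' :
  (forall w, (size w < m)%N -> f w = 0) -> (forall w, (size w < n)%N -> g w = 0) ->
  ev f (i, m, u, v) != 0 -> ev g (j, n, u', v') != 0 ->
  exists z s, ev (f * (mono K z * g)) s != 0.
Proof.
move=> flow glow /(ev_lift_le (leq_maxl i j))[{}v fN0] /(ev_lift_le (leq_maxr i j))[{}v' gN0].
set k := maxn i j in fN0 gN0; have [W e [_ /ser_neq0[w Ww]]] := BS_prefix k.
have sf := ev_neq0_size fN0; have sg := ev_neq0_size gN0.
have [z zE] : exists z, z = v ++ u' by exists (v ++ u').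
exists z, (k.+1, (m + (size z + n))%N, u, v' ++ w).
have zlow x : (size x < size z)%N -> mono K z x = 0.
  by move=> sx; rewrite hom_mono // neq_ltn sx.
have -> : ev (f * (mono K z * g)) (k.+1, (m + (size z + n))%N, u, v' ++ w) =
    ev f (k, m, u, v) * (ev g (k, n, u', v') * W w).
  rewrite /ev wsum_cat -wsumMr; apply: eq_wsum => x sx.
  rewrite wsum_cat (wsum_single (u := z)) //; last first.
    move=> z' sz' zz'; apply: wsum_eq0 => x' sx'.
    rewrite (serM_low flow (n := (size z + n)%N)) ?size_cat ?sz' ?sx' //; last first.
      by move=> t st; apply: serM_low0 st => //; exact: zlow.
    by rewrite (hom_catE _ _ (hom_mono z)) // /mono (negPf zz') mul0r !mulr0.
  rewrite -!wsumMr -wsumMl; apply: eq_wsum => x' sx'.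
  rewrite (serM_low flow (n := (size z + n)%N)) ?size_cat ?sx' //; last first.
    by move=> t st; apply: serM_low0 st => //; exact: zlow.
  rewrite (hom_catE _ _ (hom_mono z)) // /mono eqxx mul1r e -mulrA.
  have -> : u ++ (x ++ z ++ x') ++ v' ++ w = (u ++ x ++ v) ++ (u' ++ x' ++ v') ++ w.
    by rewrite zE !catA.
  rewrite (hom_catE _ _ (@homB k false)) ?size_cat ?sx -?sf 1?addnA //.
  rewrite (hom_catE _ _ (@homB k false)) ?size_cat ?sx' -?sg 1?addnA //.
  by rewrite mulrACA; congr (_ * _); ring.
by rewrite !mulf_neq0.
Qed.

(** * Windows in block words *)

Definition bspan j k f := exists c : seq bool -> K, f = wsum k (fun y => c y *: bprod (B j) y).

Lemma bspan_bprod j y : bspan j (size y) (bprod (B j) y).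
Proof.
exists (fun z => (z == y)%:R); rewrite (wsum_single (u := y)) ?eqxx ?scale1r //.
by move=> w _ /negPf ->; rewrite scale0r.
Qed.

Lemma bspan_sum j k I (s : seq I) (a : I -> K) (F : I -> ncseries K) :
  (forall i : I, bspan j k (F i)) -> bspan j k (\sum_(i <- s) a i *: F i).
Proof.
move=> spF; elim: s => [|i s [c ce]].
  by exists (fun=> 0); rewrite big_nil wsum_eq0 // => y _; rewrite scale0r.
have [d de] := spF i; exists (fun y => a i * d y + c y).
rewrite big_cons ce de (wsum_add ( *:%R (a i))) -wsumD; apply: eq_wsum => y _ /=.
by rewrite scalerDl scalerA.
Qed.

Lemma bspanM j k k' f g : bspan j k f -> bspan j k' g -> bspan j (k + k') (f * g).
Proof.
move=> [c ->] [d ->]; exists (fun y => c (take k y) * d (drop k y)).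
rewrite wsum_cat -wsumMr; apply: eq_wsum => y sy; rewrite -wsumMl; apply: eq_wsum => z sz.
by rewrite take_size_cat // drop_size_cat // bprod_cat -scalerAl -scalerAr scalerA.
Qed.

Lemma bspan_B j i : (j <= i)%N -> exists k, forall b, bspan j k (B i b).
Proof.
move=> leji; rewrite -(subnKC leji); elim: (i - j)%N => [|d [k IHd]].
  exists 1%N => b; have := bspan_bprod j [:: b].
  by rewrite bprod_cons bprod_nil mulr1 addn0.
exists ((r (j + d) + size (E (j + d)) + M (j + d)) * k)%N => b.
rewrite addnS BS; apply: bspan_sum => n.
rewrite -(@size_zword (r (j + d)) (E (j + d)) (M (j + d)) n) -1?ltnS //.
elim: (zword _ _ _ _) => [|b' y IHy]; last by rewrite bprod_cons mulSn; exact: bspanM.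
by have := bspan_bprod j [::]; rewrite !bprod_nil.
Qed.

Definition null n f := forall j u v, ev f (j, n, u, v) = 0.

Lemma ev_eq0 f : ev f = 0 <-> forall n, null n f.
Proof.
split=> [f0 n j u v|f0]; first by rewrite f0.
by apply/funext => -[[[j n] u] v]; rewrite f0.
Qed.

(** One stage suffices for the test: nonvanishing at a stage before j lifts up to j, and the
    functionals of later stages are combinations of block words of stage j. *)
Lemma null_blocks j n f :
  (forall y u v, wsum n (fun w => bprod (B j) y (u ++ w ++ v) * f w) = 0) -> null n f.
Proof.
move=> f0 i u v; apply/eqP/negPn/negP => /(ev_lift_le (leq_maxl i j))[{}v].
have [k /(_ false)[c ce]] := bspan_B (leq_maxr i j).
rewrite /ev ce; apply/negP/negPn/eqP.
under eq_wsum => w _ do rewrite ser_wsumE -wsumMr.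
rewrite wsum_exchange; apply: wsum_eq0 => y _.
under eq_wsum => w _ do rewrite serZE -mulrA.
by rewrite wsumMl f0 mulr0.
Qed.

(** A window of length at least 2 l_j contains a complete block, and that block already kills T. *)
Lemma null_killed j T n :
  (forall b u v, wsum (l j) (fun w => B j b w * T (u ++ w ++ v)) = 0) ->
  (2 * l j <= n)%N -> null n T.
Proof.
move=> kT len; apply: (@null_blocks j) => y u v.
have [sz|sz] := eqVneq (size u + n + size v)%N (size y * l j)%N; last first.
  apply: wsum_eq0 => w sw; rewrite hom_bprodB ?mul0r // !size_cat sw addnA //.
have lj := l_gt0 j; set L := l j in kT len sz lj *.
(* The quotient of [size u] by [L] rounded up: the index of the first block that starts inside the
   window. *)
pose k := ((size u + L).-1 %/ L)%N.
have uk : (size u <= k * L < size u + L)%N.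
  by have := divn_eq (size u + L).-1 L; have := ltn_pmod (size u + L).-1 lj; rewrite -/k; lia.
have ky : (k < size y)%N by rewrite -(ltn_pmul2r lj) -sz; lia.
pose n1 := (k * L - size u)%N; pose n3 := (n - n1 - L)%N.
have en : n = (n1 + (L + n3))%N by lia.
have ey := cat_take_drop k y; rewrite (drop_nth false ky) in ey.
rewrite en wsum_cat; apply: wsum_eq0 => w1 sw1; rewrite wsum_cat wsum_exchange.
apply: wsum_eq0 => w3 sw3.
have h1 := @hom_bprodB j (take k y); rewrite size_takel ?(ltnW ky) // in h1.
have h2 := @homB j (nth false y k).
set X := bprod (B j) (take k y); set Y := bprod (B j) (drop k.+1 y).
rewrite (eq_wsum (G := fun w2 => X (u ++ w1) * Y (w3 ++ v) *
   (B j (nth false y k) w2 * T (w1 ++ w2 ++ w3)))); first by rewrite wsumMl kT mulr0.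
move=> w2 sw2; rewrite -{1}ey bprod_cat bprod_cons.
have -> : u ++ (w1 ++ w2 ++ w3) ++ v = (u ++ w1) ++ w2 ++ w3 ++ v by rewrite !catA.
rewrite (hom_catE _ _ h1) ?size_cat ?sw1; last by rewrite /n1; lia.
by rewrite (hom_catE _ _ h2) // -/X -/Y; ring.
Qed.

(** * The powers of a + b b *)

Lemma pairing_tile x n w : x = mono K [:: false] + mono K [:: true; true] ->
  (x ^+ n) w = (tile K w)`_n.
Proof.
move=> xE; have x0 : x [::] = 0 by rewrite xE serDE; exact: addr0.
have xf : deriv1 false x = 1 by rewrite xE; apply/funext => v; rewrite /deriv1 serDE; exact: addr0.
have xt : deriv1 true x = mono K [:: true].
  by rewrite xE; apply/funext => v; rewrite /deriv1 serDE; exact: add0r.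
have xtt : deriv1 true (mono K [:: true]) = 1 by [].
elim: n w => [|n IHn] w.
  rewrite expr0; elim: w {xf xt xtt} => [|[] w _]; rewrite ?coef1 //=.
    by case: w => [|[] w]; rewrite ?coef0 ?coefXM.
  by rewrite coefXM.
rewrite exprS; case: w => [|[] w]; first by rewrite serM_nil x0 mul0r coef1.
  rewrite serM_cons x0 mul0r add0r xt; case: w => [|b w].
    by rewrite serM_nil mul0r coef0.
  rewrite serM_cons mul0r add0r; case: b; last first.
    have -> : deriv1 false (mono K [:: true]) = 0 by [].
    by rewrite mul0r coef0.
  by rewrite xtt mul1r IHn /= coefXM.
by rewrite serM_cons x0 mul0r add0r xf mul1r IHn /= coefXM.
Qed.

Lemma tile_coef_size w n : (tile K w)`_n != 0 -> (size w <= 2 * n)%N.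
Proof.
have [m] := ubnP (size w); elim: m w n => // m IHm [|[] w] n //= sw.
  case: w sw => [|[] w] sw; rewrite ?coef0 ?eqxx // coefXM; case: n => [|n]; rewrite ?eqxx //=.
  by move=> /IHm; move: sw => /=; lia.
rewrite coefXM; case: n => [|n]; rewrite ?eqxx //= => /IHm; lia.
Qed.

(** With x = a + b b, the leading coefficient of the symbol of p_j is a value of [ev] at x^N, and
    l_j <= 2 N because a tile has at most two letters. As j = 2n + 2 < l_j, this gives N > n, so
    x^(n+1) is a factor of x^N. *)
Lemma ev_tile_power n : ev ((mono K [:: false] + mono K [:: true; true]) ^+ n.+1) != 0.
Proof.
set x := _ + _; apply/eqP => x0; have [_ _ _ /(_ false) sN0 _] := gB n.*2.+2.
set j := n.*2.+2 in sN0; set N := (size (symbol (l j) (B j false))).-1.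
have : (symbol (l j) (B j false))`_N != 0 by rewrite -/(lead_coef _) lead_coef_eq0.
have -> : (symbol (l j) (B j false))`_N = ev (x ^+ N) (j, l j, [::], [::]).
  rewrite /symbol -[LHS]/(coefp N _) (wsum_add (coefp N)); apply: eq_wsum => w sw /=.
  by rewrite cats0 (@pairing_tile x) // coefZ.
move=> /[dup] /wsum_neq0[w sw]; rewrite (@pairing_tile x) // mulf_eq0 negb_or.
move=> /andP[_ /tile_coef_size]; rewrite sw => lN.
have -> : N = (n.+1 + (N - n.+1))%N by have := ltn_l j; rewrite /j in lN *; lia.
by rewrite exprD (ev_ideal _ x0).1 eqxx.
Qed.

(** If q were a multiple of p, their symbols would have the same size. So p and q have a nonzero 2 x
    2 minor d at some words w1 and w2, and Cramer's rule gives the dual basis in the span of these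
    words. *)
Lemma dual_pair j : exists a : bool -> ncseries K, (forall b, homogeneous (l j) (a b)) /\
  forall b b', pairing (l j) (B j b) (a b') = (b == b')%:R.
Proof.
have [w1 pw1] := ser_neq0 (B_neq0 j false).
set p := B j false in pw1 *; set q := B j true.
have [w2 dN0] : exists w2, p w1 * q w2 - q w1 * p w2 != 0.
  apply: contrapT => H; have qE : q = (q w1 / p w1) *: p.
    apply/funext => w; rewrite serZE; apply: (mulfI pw1).
    rewrite mulrA mulrCA divff // mulr1; apply/eqP; rewrite -subr_eq0.
    by apply/negPn/negP => dw; apply: H; exists w.
  have [_ _ _ sN0 /negP] := gB j; apply.
  have symq : symbol (l j) q = (q w1 / p w1) *: symbol (l j) p.
    rewrite {1}qE; have := symbol_sum (l j) [:: tt] xpredT (fun=> q w1 / p w1) (fun=> p).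
    by rewrite !big_seq1.
  have cN0 : q w1 / p w1 != 0.
    by apply/eqP => c0; have := sN0 true; rewrite symq c0 scale0r eqxx.
  by rewrite -/q symq size_scale.
set d := _ - _ in dN0.
have sw1 := hom_neq0 (@homB j false) pw1.
have sw2 : size w2 = l j.
  apply/eqP; apply: contraNT dN0 => sw2; rewrite /d /p /q !(@homB j _ w2 sw2).
  by rewrite !mulr0 subr0.
pose a (b : bool) := if b then d^-1 *: (p w1 *: mono K w2 - p w2 *: mono K w1)
  else d^-1 *: (q w2 *: mono K w1 - q w1 *: mono K w2).
exists a; split=> [b|b b'].
  have h1 := hom_mono (K := K) w1; have h2 := hom_mono (K := K) w2.
  rewrite sw1 in h1; rewrite sw2 in h2.
  by case: b; rewrite /a -scaleNr; apply: homZ; apply: homD; apply: homZ.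
have pm f : pairing (l j) f (mono K w1) = f w1 by rewrite -sw1 pairing_mono.
have pm' f : pairing (l j) f (mono K w2) = f w2 by rewrite -sw2 pairing_mono.
case: b; case: b'; rewrite /a pairingZr -scaleNr pairingDr !pairingZr pm pm' -/p -/q mulNr /=.
- by rewrite [p w2 * _]mulrC mulVf.
- by rewrite [q w2 * _]mulrC subrr mulr0.
- by rewrite [p w2 * _]mulrC subrr mulr0.
- by rewrite [q w2 * _]mulrC mulVf.
Qed.

Lemma pairing_bprod j (a : bool -> ncseries K) y z : (forall b, homogeneous (l j) (a b)) ->
  (forall b b', pairing (l j) (B j b) (a b') = (b == b')%:R) ->
  pairing (size y * l j) (bprod (B j) y) (bprod a z) = (y == z)%:R.
Proof.
move=> ha pa; have [szz|szz] := eqVneq (size y) (size z); last first.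
  rewrite (pairing_hom0 _ (hom_bprod (y := z) ha)) ?eqn_pmul2r ?l_gt0 //.
  by have [e|//] := eqVneq y z; rewrite e eqxx in szz.
elim: y z szz => [|b y IHy] [|b' z] //= => [_|[] szz].
  by rewrite !bprod_nil /pairing /= !ser1E mulr1.
rewrite !bprod_cons mulSn pairingM ?pa ?IHy //; last exact: homB.
by rewrite -natrM mulnb eqseq_cons.
Qed.

Lemma tail_coef j : exists2 n, (n <= M j)%N & C j false n != 0.
Proof.
apply: contrapT => H; have /negP := tail_neq0 j false; apply.
rewrite /tail_part big1 ?mulr0 // => n _.
have [->|cN0] := eqVneq (C j false n) 0; first by rewrite scale0r.
by case: H; exists n; rewrite // -ltnS.
Qed.

Lemma bprod_nseq j k b : bprod (B j) (nseq k b) = B j b ^+ k.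
Proof. by rewrite /bprod big_nseq; elim: k => //= k ->; rewrite exprS. Qed.

Lemma homBX j k b : homogeneous (k * l j) (B j b ^+ k).
Proof. by rewrite -bprod_nseq -{1}(size_nseq k b); exact: hom_bprodB. Qed.

(** The block word p^t E p^n q^(m-n) p^t' with E = q F. The leading q of E marks the end of the run
    p^t, so that t, n and t' can be read off. *)
Definition marked_word (F : seq bool) (m n t t' : nat) : seq bool :=
  nseq t false ++ (true :: F) ++ (nseq n false ++ nseq (m - n) true) ++ nseq t' false.

Lemma marked_word_inj F m n1 n2 t1 t2 t1' t2' : (n1 <= m)%N -> (n2 <= m)%N ->
  marked_word F m n1 t1 t1' = marked_word F m n2 t2 t2' -> [/\ n1 = n2, t1 = t2 & t1' = t2'].
Proof.
move=> le1 le2 eqw; have fw n t t' : find id (marked_word F m n t t') = t.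
  by rewrite find_cat has_nseq andbF size_nseq /= addn0.
have et : t1 = t2 by rewrite -(fw n1 t1 t1') eqw fw.
move: eqw; rewrite /marked_word et => /eqP; rewrite eqseq_cat // eqseq_cat // eqseq_cat; last first.
  by rewrite !size_cat !size_nseq; lia.
case/and4P=> _ _ /eqP /(congr1 (count negb)) en /eqP /(congr1 size).
rewrite !size_nseq => <-; split=> //.
by move: en; rewrite !count_cat !count_nseq /=; lia.
Qed.

(** With T the tail, p_{j+2} begins with p^r T p^r T. Leaving p^(r-t0) on the left and p^(r-t0') T
    with all that follows on the right, the window is p^t0 T p^t0'. Pairing it with dual words gives
    coordinates that separate the pairs (t, t'). *)
Lemma ev_marked j (a : bool -> ncseries K) F n0 t0 t0' : (forall b, homogeneous (l j) (a b)) ->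
  (forall b b', pairing (l j) (B j b) (a b') = (b == b')%:R) ->
  E j = true :: F -> (n0 <= M j)%N -> C j false n0 != 0 -> (t0 <= r j)%N -> (t0' <= r j)%N ->
  exists s (k : K), k != 0 /\ forall t t',
    ev (bprod a (marked_word F (M j) n0 t t')) s = k * ((t == t0) && (t' == t0'))%:R.
Proof.
move=> ha pa EF len0 cN0 le0 le0'; have [W eW [hW WN0]] := BS_prefix j.+1.
have [p pE] : exists p, p = B j false by exists (B j false).
pose T := tail_part j false.
have eB : B j.+2 false = p ^+ (r j - t0) * (p ^+ t0 * T * p ^+ t0') * (p ^+ (r j - t0') * (T * W)).
  rewrite eW BSE -pE -/T -{1}(subnK le0) -{2}(subnKC le0') !exprD.
  by rewrite !mulrA.
have hp k : homogeneous (k * l j) (p ^+ k) by rewrite pE; exact: homBX.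
have hT : homogeneous ((size (E j) + M j) * l j) T := @hom_tail j false.
have pN0 k : p ^+ k != 0 by rewrite pE -bprod_nseq bprod_neq0.
have hY := homM (homM (hp t0) hT) (hp t0').
have hZ := homM (hp (r j - t0')%N) (homM hT hW).
have [u Xu] := ser_neq0 (pN0 (r j - t0)%N).
have ZN0 : p ^+ (r j - t0') * (T * W) != 0.
  by rewrite (hom_mul_neq0 (hp _)) // (hom_mul_neq0 hT) // tail_neq0.
have [v Zv] := ser_neq0 ZN0.
exists (j.+2, (t0 * l j + (size (E j) + M j) * l j + t0' * l j)%N, u, v),
  ((p ^+ (r j - t0)) u * (p ^+ (r j - t0') * (T * W)) v * C j false n0).
split=> [|t t']; first by rewrite !mulf_neq0.
rewrite (ev_factor _ eB (hp _) hY hZ (hom_neq0 (hp _) Xu) (hom_neq0 hZ Zv)) -[RHS]mulrA.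
congr (_ * _).
have -> : p ^+ t0 * T * p ^+ t0' =
    \sum_(n < (M j).+1) C j false n *: bprod (B j) (marked_word F (M j) n t0 t0').
  rewrite /T /tail_part !(mulr_sumr, mulr_suml); apply: eq_bigr => n _.
  rewrite /marked_word -EF !bprod_cat !bprod_nseq -pE.
  by rewrite -!scalerAr -scalerAl !mulrA.
rewrite pairing_suml (bigD1 (Ordinal (len0 : (n0 < (M j).+1)%N))) //=.
have pm (n : nat) : (n <= M j)%N -> pairing (t0 * l j + (size (E j) + M j) * l j + t0' * l j)
    (C j false n *: bprod (B j) (marked_word F (M j) n t0 t0'))
    (bprod a (marked_word F (M j) n0 t t')) =
    C j false n * ((n == n0) && ((t == t0) && (t' == t0')))%:R.
  move=> len; rewrite pairingZl; congr (_ * _).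
  have := pairing_bprod (marked_word F (M j) n t0 t0') (marked_word F (M j) n0 t t') ha pa.
  rewrite {1}/marked_word -EF !size_cat !size_nseq subnKC //.
  rewrite !mulnDl !addnA => ->.
  congr (_%:R); congr nat_of_bool; apply/eqP/idP => [/marked_word_inj[]// -> -> ->|].
    by rewrite !eqxx.
  by case/and3P=> /eqP -> /eqP -> /eqP ->.
rewrite pm // eqxx /= big1 ?addr0 // => n nn0; rewrite pm -1?ltnS //.
by have -> : (n == n0 :> nat) = false;
  [apply: negbTE; apply: contra nn0 => /eqP e; apply/eqP/val_inj | rewrite mulr0].
Qed.

(** The window is the factor y of E_j = q y inside p_{j+1}; everything else goes into the two
    contexts. *)
Lemma ev_word j (a : bool -> ncseries K) y : (forall b, homogeneous (l j) (a b)) ->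
  (forall b b', pairing (l j) (B j b) (a b') = (b == b')%:R) ->
  E j = true :: y ->
  exists s (k : K), k != 0 /\ forall z, ev (bprod a z) s = k * (z == y)%:R.
Proof.
move=> ha pa Ey.
pose W := \sum_(n < (M j).+1) C j false n *: bprod (B j) (nseq n false ++ nseq (M j - n) true).
have hW : homogeneous (M j * l j) W.
  apply: hom_sum => n _; apply: homZ; have := @hom_bprodB j (nseq n false ++ nseq (M j - n) true).
  by rewrite size_cat !size_nseq subnKC // -ltnS.
have WN0 : W != 0.
  by have := tail_neq0 j false; rewrite /tail_part -/W; apply: contra => /eqP ->; rewrite mulr0.
have eB : B j.+1 false = (B j false ^+ r j * B j true) * bprod (B j) y * W.
  by rewrite BSE /tail_part -/W Ey bprod_cons !mulrA.
have hX := homM (@homBX j (r j) false) (@homB j true).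
have hY := @hom_bprodB j y.
have XN0 : B j false ^+ r j * B j true != 0.
  by rewrite (hom_mul_neq0 (@homBX j (r j) false)) ?B_neq0 // -bprod_nseq bprod_neq0.
have [u Xu] := ser_neq0 XN0; have [v Wv] := ser_neq0 WN0.
exists (j.+1, (size y * l j)%N, u, v), ((B j false ^+ r j * B j true) u * W v).
split=> [|z]; first by rewrite mulf_neq0.
rewrite (ev_factor _ eB hX hY hW (hom_neq0 hX Xu) (hom_neq0 hW Wv)).
by rewrite pairing_bprod // [y == z]eq_sym.
Qed.

(** * Codimension of the kernel in each degree *)

Hypothesis B0 : forall b, B 0%N b = mono K [:: b; b].

(** A bound on the cut rank of p_j and q_j: stage i sums [(M i).+1] block words and products do not
    raise the rank, so [r] does not enter. *)
Fixpoint rk (j : nat) : nat := if j is i.+1 then ((M i).+1 * rk i)%N else 1%N.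

Lemma rk_gt0 j : (0 < rk j)%N.
Proof. by elim: j => // j; rewrite /= muln_gt0. Qed.

Lemma cutrank_bprod_of j y : (forall b, cutrank (rk j) (B j b)) ->
  cutrank (rk j) (bprod (B j) y).
Proof.
move=> cB; elim: y => [|b y IHy].
  rewrite bprod_nil; exact: cutrank_leq (rk_gt0 j) (cutrank_mono_word K [::]).
by rewrite bprod_cons; apply: cutrankM (@homB j b) _ _.
Qed.

Lemma cutrank_B j b : cutrank (rk j) (B j b).
Proof.
elim: j b => [|j IHj] b; first by rewrite B0; exact: cutrank_mono_word.
rewrite BS; apply: (cutrank_sum _ _ (F := fun n => bprod (B j) (zword (r j) (E j) (M j) n))) => n.
exact: cutrank_bprod_of.
Qed.

Lemma cutrank_bprod j y : cutrank (rk j) (bprod (B j) y).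
Proof. by apply: cutrank_bprod_of => b; exact: cutrank_B. Qed.

Definition killed j m t y f := forall u v, size u = t ->
  wsum m (fun w => bprod (B j) y (u ++ w ++ v) * f w) = 0.

(** The end of the first block cuts the window in two. Expanding the first block at position t and
    the others at the end of the window leaves [rk j] functionals on either part, the same for all
    contexts u and v. *)
Lemma codim_killed j m t y : (t <= l j)%N -> (l j - t <= m)%N -> (0 < m)%N ->
  codim_le (killed j m t y) (rk j * rk j).
Proof.
move=> letl lem m0; case: y => [|b y].
  apply: codim_le0 => f u v su; apply: wsum_eq0 => w sw.
  by rewrite bprod_nil ser1E -size_eq0 !size_cat sw; case: m m0 {lem sw} => // m _; rewrite addnCA mul0r.
have [al [be e1]] := @cutrank_B j b t.
have [al' [be' e2]] := @cutrank_bprod j y (m - (l j - t))%N.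
pose d := (l j - t)%N.
exists ('I_(rk j) * 'I_(rk j))%type, (fun (k : 'I_(rk j) * 'I_(rk j)) f => wsum m (fun w =>
  be k.1 (take d w) * al' k.2 (drop d w) * f w)); split.
- by rewrite card_prod card_ord.
- move=> k c f g; rewrite -wsumMl -wsumD; apply: eq_wsum => w _.
  by rewrite serDE serZE mulrDr mulrCA.
move=> f H u v su.
transitivity (\sum_(k < rk j) \sum_(k' < rk j) al k u * be' k' v *
  wsum m (fun w => be k (take d w) * al' k' (drop d w) * f w)); last first.
  by rewrite big1 // => k _; rewrite big1 // => k' _; rewrite (H (k, k')) mulr0.
under [RHS]eq_bigr => k _ do (under eq_bigr => k' _ do rewrite -wsumMl).
under [RHS]eq_bigr => k _ do rewrite -wsum_big; rewrite -wsum_big.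
apply: eq_wsum => w sw; rewrite bprod_cons -{1}(cat_take_drop d w).
have -> : u ++ (take d w ++ drop d w) ++ v = (u ++ take d w) ++ (drop d w ++ v) by rewrite !catA.
rewrite (hom_catE _ _ (@homB j b)); last by rewrite size_cat su size_takel ?sw ?subnKC.
rewrite (e1 _ _ su) e2; last by rewrite size_drop sw.
rewrite -mulrA mulr_suml; apply: eq_bigr => k _; rewrite mulr_suml mulr_sumr.
by apply: eq_bigr => k' _; ring.
Qed.

(** The window lies within [L] consecutive blocks, from block [o] on; the blocks on either side see
    only the contexts and factor out. *)
Lemma wsum_window j m t f y o L u v : (o + L <= size y)%N -> size u = (o * l j + t)%N ->
  (t + m <= L * l j)%N -> killed j m t (take L (drop o y)) f ->
  wsum m (fun w => bprod (B j) y (u ++ w ++ v) * f w) = 0.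
Proof.
move=> oL su tm kf.
have [sz|sz] := eqVneq (size u + m + size v)%N (size y * l j)%N; last first.
  apply: wsum_eq0 => w sw; rewrite hom_bprodB ?mul0r // !size_cat sw addnA //.
have ey : y = take o y ++ take L (drop o y) ++ drop L (drop o y) by rewrite !cat_take_drop.
pose u0 := take (o * l j) u; pose u1 := drop (o * l j) u.
pose d := (L * l j - t - m)%N; pose v1 := take d v; pose v2 := drop d v.
have sov : (L * l j - t - m <= size v)%N.
  have : ((o + L) * l j <= size y * l j)%N by rewrite leq_pmul2r ?l_gt0.
  by rewrite -sz su mulnDl; lia.
have su0 : size u0 = (o * l j)%N by rewrite size_takel // su leq_addr.
have su1 : size u1 = t by rewrite size_drop su addKn.
have sv1 : size v1 = d by rewrite size_takel.
have h1 := @hom_bprodB j (take o y); rewrite size_takel in h1; last by lia.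
have h2 := @hom_bprodB j (take L (drop o y)).
rewrite size_takel in h2; last by rewrite size_drop; lia.
rewrite (eq_wsum (G := fun w => bprod (B j) (take o y) u0 *
    bprod (B j) (drop L (drop o y)) v2 *
    (bprod (B j) (take L (drop o y)) (u1 ++ w ++ v1) * f w))).
  by rewrite wsumMl (kf _ _ su1) mulr0.
move=> w sw; rewrite {1}ey !bprod_cat.
have -> : u ++ w ++ v = u0 ++ (u1 ++ w ++ v1) ++ v2.
  by rewrite -{1}(cat_take_drop (o * l j) u) -{1}(cat_take_drop d v) !catA.
rewrite (hom_catE _ _ h1) // (hom_catE _ _ h2); last by rewrite !size_cat su1 sw sv1 /d; lia.
by ring.
Qed.

(* A window that starts before position rr - L lies in the prefix p ^ rr, hence is equal to
   the window starting at rr - L: the number of windows does not depend on rr. *)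
Lemma window_reduce rr (F : seq bool) mm n n' L o : (n <= mm)%N -> (n' <= mm)%N ->
  (o < rr + size F + mm)%N ->
  exists2 o', (o' < L + (2 * (size F + mm)).+1)%N &
    take L (drop o (zword rr F mm n ++ zword rr F mm n')) =
    take L (drop (rr - L + o') (zword rr F mm n ++ zword rr F mm n')).
Proof.
move=> len len' o_lt; have [leo|lt] := leqP (rr - L) o.
  by exists (o - (rr - L))%N; [lia | rewrite subnKC].
exists 0%N; first by rewrite addnC.
have take_false k (s : seq bool) : (k + L <= rr)%N -> take L (drop k (nseq rr false ++ s)) = nseq L false.
  move=> kL; have -> : nseq rr false = nseq k false ++ nseq L false ++ nseq (rr - k - L) false.
    by rewrite -!nseqD; congr nseq; lia.
  by rewrite -!catA drop_size_cat ?size_nseq // take_size_cat ?size_nseq.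
by rewrite /zword -!catA addn0 !take_false //; lia.
Qed.

(** A window of length m < l_{j+1} meets at most two blocks of stage j + 1, each a combination of M
    + 1 words [zword] of stage j. The factors count these two words, the starting block after
    [window_reduce], the offset in it, and the conditions of [codim_killed]. *)
Lemma codim_null j m : (l j <= m < l j.+1)%N -> codim_le (null m)
  ((M j).+1 * ((M j).+1 * ((m %/ l j + 2 + (2 * (size (E j) + M j)).+1) * (l j * (rk j * rk j))))).
Proof.
case/andP=> lem ltm; have lj := l_gt0 j.
(* [L] blocks cover a window of length m at any offset less than l_j. *)
set L := (m %/ l j + 2)%N; set h := (size (E j) + M j)%N.
pose z n := zword (r j) (E j) (M j) n.
apply: (@codim_le_sub _ (fun f => forall n, (n < (M j).+1)%N -> forall n', (n' < (M j).+1)%N ->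
    forall o, (o < L + (2 * h).+1)%N -> forall t, (t < l j)%N ->
    killed j m t (take L (drop (r j - L + o) (z n ++ z n'))) f)); last first.
- apply: codim_le_forall_const => n _; apply: codim_le_forall_const => n' _.
  apply: codim_le_forall_const => o _; apply: codim_le_forall_const => t ltt.
  by apply: codim_killed; [exact: ltnW | lia | lia].
- exact: leqnn.
move=> f Q; set R := (r j + size (E j) + M j)%N.
have dm : (m < (m %/ l j).+1 * l j)%N by rewrite {1}(divn_eq m (l j)) mulSn addnC ltn_add2r ltn_pmod.
have szz n : (n < (M j).+1)%N -> size (z n) = R by move=> len; rewrite size_zword.
have kz n n' t u v : (n < (M j).+1)%N -> (n' < (M j).+1)%N -> size u = t -> (t < R * l j)%N ->
    wsum m (fun w => bprod (B j) (z n ++ z n') (u ++ w ++ v) * f w) = 0.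
  move=> ltn ltn' su tR.
  have o_lt : (t %/ l j < R)%N by rewrite ltn_divLR.
  have [k o_lt' eo] := @window_reduce (r j) (E j) (M j) n n' L _ ltn ltn' o_lt.
  apply: (@wsum_window j m (t %% l j) f _ (t %/ l j) L).
  - rewrite size_cat !szz // /L; have : (m %/ l j < R)%N by rewrite ltn_divLR // /R -lS.
    by lia.
  - by rewrite su -divn_eq.
  - have := ltn_pmod t lj; rewrite /L mulnDl; move: dm; rewrite mulSn mul2n -addnn; lia.
  - by rewrite eo; apply: Q => //; exact: ltn_pmod.
have kB b b' t : (t < l j.+1)%N -> killed j.+1 m t [:: b; b'] f.
  move=> ltt u v su; rewrite !bprod_cons bprod_nil mulr1 !BS.
  rewrite (eq_wsum (G := fun w => \sum_(n < (M j).+1) \sum_(n' < (M j).+1)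
      C j b n * C j b' n' * (bprod (B j) (z n ++ z n') (u ++ w ++ v) * f w))).
    rewrite wsum_big big1 // => n _; rewrite wsum_big big1 // => n' _.
    by rewrite wsumMl (@kz n n' t) ?mulr0 // /R -lS.
  move=> w _; rewrite serM_sum2 mulr_suml; apply: eq_bigr => n _.
  by rewrite mulr_suml; apply: eq_bigr => n' _; rewrite -bprod_cat mulrA.
apply: (@null_blocks j.+1) => Y u v.
have lj1 := l_gt0 j.+1.
have [sz|sz] := eqVneq (size u + m + size v)%N (size Y * l j.+1)%N; last first.
  apply: wsum_eq0 => w sw; rewrite hom_bprodB ?mul0r // !size_cat sw addnA //.
pose k := (size u %/ l j.+1)%N; have ek := divn_eq (size u) (l j.+1); rewrite -/k in ek.
have kY : (k < size Y)%N by rewrite ltn_divLR // -sz; lia.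
(* The window may lie in the last block of [Y]. One more block p, evaluated at a word w0 where it
   does not vanish, makes two blocks available. *)
have [w0 Bw0] := ser_neq0 (B_neq0 j.+1 false).
apply: (mulIf Bw0); rewrite mul0r -wsumMr.
rewrite (eq_wsum (G := fun w => bprod (B j.+1) (Y ++ [:: false]) (u ++ w ++ (v ++ w0)) * f w)).
  have lt2 : (size u %% l j.+1 < l j.+1)%N by rewrite ltn_pmod.
  apply: (@wsum_window j.+1 m (size u %% l j.+1) f _ k 2) => //.
  - by rewrite size_cat /=; lia.
  - by rewrite mul2n -addnn; lia.
  - have : size (take 2 (drop k (Y ++ [:: false]))) = 2%N.
      by rewrite size_takel // size_drop size_cat /=; lia.
    case: (take 2 _) => [|b [|b' [|? ?]]] //= _; exact: kB.
move=> w sw; rewrite bprod_cat bprod_cons bprod_nil mulr1.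
have -> : u ++ w ++ v ++ w0 = (u ++ w ++ v) ++ w0 by rewrite !catA.
rewrite (hom_catE _ _ (@hom_bprodB j.+1 Y)); last by rewrite !size_cat sw -sz addnA.
by rewrite mulrAC.
Qed.

(** It depends on M and E up to stage j but on no r_i, so r_j can be chosen large against it. The
    factor l_j of [codim_null] is absorbed by m >= l_j in [codim_null_linear]. *)
Definition stage_const (j : nat) : nat :=
  ((M j).+1 ^ 2 * rk j ^ 2 * (2 * (size (E j) + M j) + 4))%N.

Lemma codim_null_linear j m : (l j <= m < l j.+1)%N -> codim_le (null m) (m * stage_const j).
Proof.
move=> /[dup] /andP[lem _] /codim_null; apply: codim_le_sub => //.
have : (m %/ l j * l j <= m)%N by exact: leq_divM.
rewrite /stage_const; set h := (size (E j) + M j)%N; set q := (m %/ l j)%N => qm.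
have e : ((q + 2 + (2 * h).+1) * l j <= m * (2 * h + 4))%N.
  have -> : ((q + 2 + (2 * h).+1) * l j = q * l j + (2 * h + 3) * l j)%N by lia.
  have : ((2 * h + 3) * l j <= (2 * h + 3) * m)%N by rewrite leq_mul2l lem orbT.
  by lia.
set a := (M j).+1; set b := rk j.
have -> : (a * (a * ((q + 2 + (2 * h).+1) * (l j * (b * b)))) =
  a ^ 2 * b ^ 2 * ((q + 2 + (2 * h).+1) * l j))%N by rewrite !expnS !expn0; ring.
have -> : (m * (a ^ 2 * b ^ 2 * (2 * h + 4)) = a ^ 2 * b ^ 2 * (m * (2 * h + 4)))%N by ring.
by rewrite leq_mul2l e orbT.
Qed.

Lemma stage_const_gt0 j : (0 < stage_const j)%N.
Proof. by rewrite /stage_const !muln_gt0 rk_gt0 addn_gt0 orbT. Qed.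

Definition stage_bound (j : nat) : nat := (\sum_(i < j.+1) stage_const i)%N.

Lemma stage_bound_gt0 j : (0 < stage_bound j)%N.
Proof.
by rewrite /stage_bound big_ord_recr /= addn_gt0 stage_const_gt0 orbT.
Qed.

Lemma exists_stage m : (1 < m)%N -> exists j, (l j <= m < l j.+1)%N.
Proof.
move=> m1; have ex0 : exists j, (l j <= m)%N by exists 0%N; rewrite l0.
have bnd j : (l j <= m)%N -> (j <= m)%N by move=> le; apply: leq_trans (ltnW (ltn_l j)) le.
have [j lej maxj] := ex_maxnP ex0 bnd; exists j; rewrite lej ltnNge.
by apply/negP => /maxj; rewrite ltnn.
Qed.

Lemma codim_null_small m : (m < 2)%N -> codim_le (null m) 2.
Proof.
move=> m2; exists bool, (fun b f => f (nseq m b)); split; rewrite ?card_bool //.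
move=> f f0 j u v; apply: wsum_eq0 => w sw.
suff -> : f w = 0 by rewrite mulr0.
by case: w sw m2 f0 => [<- _ /(_ true) //|c [|? ?] <- //= _].
Qed.

(** There are n + 1 <= 2 n degrees, each contributing at most n s + 2 <= 3 n s with s =
    [stage_bound i]; the summand 2 accounts for the degrees below l_0 = 2. *)
Lemma codim_null_upto i n : (0 < n)%N -> (n < l i.+1)%N ->
  codim_le (fun f => forall m, (m < n.+1)%N -> null m f) (6 * n ^ 2 * stage_bound i).
Proof.
move=> n0 ltn; pose N := (n * stage_bound i + 2)%N.
have H m : (m < n.+1)%N -> codim_le (null m) N; last first.
  apply: codim_le_sub (codim_le_forall_const H) => //.
  have s0 := stage_bound_gt0 i; rewrite /N -mulnn.
  have : (0 < n * stage_bound i)%N by rewrite muln_gt0 n0.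
  nia.
rewrite ltnS => lemn; have [m1|m1] := ltnP 1 m; last first.
  by apply: (@codim_le_sub _ (null m) _ 2 N) => //; [exact: leq_addl | exact: codim_null_small].
have [j /[dup] jm /andP[lejm _]] := exists_stage m1.
have leji : (j <= i)%N.
  rewrite -ltnS ltnNge; apply/negP => /leq_l leij.
  by have := leq_trans leij (leq_trans lejm lemn); rewrite leqNgt ltn.
apply: (@codim_le_sub _ (null m) _ (m * stage_const j) N _ _ (codim_null_linear jm)) => //.
rewrite /N; apply: leq_trans (leq_addr _ _); apply: leq_mul => //.
by rewrite /stage_bound (bigD1 (Ordinal (leji : (j < i.+1)%N))) //= leq_addr.
Qed.

(** * The quotient algebra *)

Section QuotientAlgebra.
Variables (A : nuAlgType K) (pi : ncseries K -> A)
  (e : A -> nat * nat * seq bool * seq bool -> K^o).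
Hypotheses (e_inj : injective e) (e_pi : forall f, nonunital_poly f -> e (pi f) = ev f)
  (pi_surj : forall x, exists2 f, nonunital_poly f & x = pi f)
  (piL : forall c f g, nonunital_poly f -> nonunital_poly g ->
     pi (c *: f + g) = c *: pi f + pi g)
  (piM : forall f g, nonunital_poly f -> nonunital_poly g -> pi (f * g) = pi f ** pi g).

Lemma pi0 : pi 0 = 0.
Proof.
have := piL (-1) (nonunital_poly0 K) (nonunital_poly0 K).
by rewrite scaleN1r oppr0 addr0 => ->; rewrite scaleN1r addNr.
Qed.

Lemma pi_eq0 f : nonunital_poly f -> pi f = 0 <-> forall n, null n f.
Proof.
move=> Pf; rewrite -ev_eq0 -e_pi //; split=> [->|e0].
  rewrite -pi0 e_pi; last exact: nonunital_poly0.
  by apply/ev_eq0 => n j u v; apply: wsum_eq0 => w _; rewrite ser0E mulr0.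
apply: e_inj; rewrite e0 -pi0 e_pi; last exact: nonunital_poly0.
by apply/esym/ev_eq0 => n j u v; apply: wsum_eq0 => w _; rewrite ser0E mulr0.
Qed.

Lemma nonunital_polyD f g : nonunital_poly f -> nonunital_poly g -> nonunital_poly (f + g).
Proof. by move=> Pf Pg; rewrite -[f]scale1r; exact: nonunital_polyL. Qed.

Lemma piD f g : nonunital_poly f -> nonunital_poly g -> pi (f + g) = pi f + pi g.
Proof. by move=> Pf Pg; rewrite -[f in LHS]scale1r piL // scale1r. Qed.

Lemma nonunital_poly_sum I (s : seq I) (c : I -> K) (F : I -> ncseries K) :
  (forall i : I, nonunital_poly (F i)) -> nonunital_poly (\sum_(i <- s) c i *: F i).
Proof.
move=> PF; elim: s => [|i s IHs]; first by rewrite big_nil; exact: nonunital_poly0.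
by rewrite big_cons; exact: nonunital_polyL.
Qed.

Lemma pi_sum I (s : seq I) (c : I -> K) (F : I -> ncseries K) :
  (forall i : I, nonunital_poly (F i)) -> pi (\sum_(i <- s) c i *: F i) = \sum_(i <- s) c i *: pi (F i).
Proof.
move=> PF; elim: s => [|i s IHs]; first by rewrite !big_nil pi0.
by rewrite !big_cons piL ?IHs //; exact: nonunital_poly_sum.
Qed.

Lemma pi_sum_hcomp f D : nonunital_poly f -> (forall w, (D < size w)%N -> f w = 0) ->
  pi f = \sum_(n < D.+1) pi (hcomp n f).
Proof.
move=> Pf fD; rewrite {1}(sum_hcomp fD).
under eq_bigr => n _ do rewrite -[hcomp n f]scale1r.
rewrite pi_sum; last by move=> n; exact: nonunital_hcomp.
by apply: eq_bigr => n _; rewrite scale1r.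
Qed.

Lemma nonunital_mono w : w != [::] -> nonunital_poly (mono K w).
Proof. by case: w => // c w _; exact: nonunital_hom (hom_mono (c :: w)). Qed.

(** * Grading and generators *)

Definition grade (n : nat) : set A := [set x | exists f, [/\ nonunital_poly f, homogeneous n f & x = pi f]].

Lemma grade_subspace n : linear_subspace (grade n).
Proof.
apply/linear_subspaceP; split.
  by exists 0; split; [exact: nonunital_poly0 | exact: hom0 | rewrite pi0].
move=> c x y [f [Pf hf ->]] [g [Pg hg ->]]; exists (c *: f + g); split; last by rewrite piL.
- exact: nonunital_polyL.
- by apply: homD => //; apply: homZ.
Qed.

Lemma grade_sum0 N (c : nat -> A) : (forall n, grade n (c n)) -> \sum_(n < N) c n = 0 ->
  forall n, (n < N)%N -> c n = 0.
Proof.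
move=> /choice[f fP]; have Pf n : nonunital_poly (f n) by have [] := fP n.
have hf n : homogeneous n (f n) by have [] := fP n.
have cE n : c n = pi (f n) by have [] := fP n.
under eq_bigr => n _ do rewrite cE -[pi _]scale1r.
rewrite -pi_sum // => /pi_eq0 f0 n ltn; rewrite cE; apply/pi_eq0 => // m j u v.
have [->|nm] := eqVneq m n; last by rewrite (ev_hom0 _ _ _ (hf n)).
have := f0 (nonunital_poly_sum _ _ (fun i : 'I_N => Pf i)) n j u v.
rewrite ev_sum (bigD1 (Ordinal ltn)) //= mul1r big1 ?addr0 // => i.
rewrite -val_eqE eq_sym /= => ni.
by rewrite (ev_hom0 _ _ _ (hf i)) ?mulr0.
Qed.

Lemma grade_grading : is_grading grade.
Proof.
split.
- exact: grade_subspace.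
- move=> m n x y [f [Pf hf ->]] [g [Pg hg ->]]; exists (f * g).
  by split; [exact: nonunital_polyM | exact: homM | rewrite piM].
- move=> x; have [f Pf ->] := pi_surj x; have [_ [D fD]] := Pf.
  exists D.+1, (fun n => pi (hcomp n f)); split; last exact: pi_sum_hcomp.
  by move=> n; exists (hcomp n f); split=> //; [exact: nonunital_hcomp | exact: hom_hcomp].
- exact: grade_sum0.
Qed.

Lemma pi_in_subspace (W : set A) n f : linear_subspace W -> nonunital_poly f ->
  (forall u, (0 < size u <= n)%N -> W (pi (mono K u))) -> (forall w, (n < size w)%N -> f w = 0) ->
  W (pi f).
Proof.
move=> Wl Pf Wm fn; rewrite (pi_sum_hcomp Pf fn); apply: subspace_sum => // -[[|m] ltm] _ /=.
  suff -> : hcomp 0 f = 0 by rewrite pi0; exact: subspace0.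
  by apply/funext => -[|c w] //; rewrite /hcomp Pf.1.
rewrite hcomp_wsum.
suff H k F : (forall u, size u = k -> nonunital_poly (F u) /\ W (pi (F u))) ->
    nonunital_poly (wsum k F) /\ W (pi (wsum k F)).
  apply: (H _ _ _).2 => u su.
  have Pu : nonunital_poly (mono K u) by apply: nonunital_mono; rewrite -size_eq0 su.
  split; first by rewrite -[_ *: _]addr0; apply: nonunital_polyL => //; exact: nonunital_poly0.
  rewrite -[_ *: mono K u]addr0 piL // ?pi0 ?addr0; last exact: nonunital_poly0.
  by apply: subspaceZ => //; apply: Wm; rewrite su.
elim: k F => [|k IHk] F FP /=; first exact: FP.
have [|P1 W1] := IHk (fun w => F (false :: w)); first by move=> u su; apply: FP; rewrite /= su.
have [|P2 W2] := IHk (fun w => F (true :: w)); first by move=> u su; apply: FP; rewrite /= su.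
by split; [exact: nonunital_polyD | rewrite piD //; exact: subspaceD].
Qed.

Lemma pi_mono_cons c w : w != [::] -> pi (mono K (c :: w)) = pi (mono K [:: c]) ** pi (mono K w).
Proof. by move=> w0; rewrite -piM ?mono_cat //; exact: nonunital_mono. Qed.

Lemma letters_generate : generates [set` [:: pi (mono K [:: false]); pi (mono K [:: true])]].
Proof.
apply/seteqP; split=> // x _ S [[Sl SM] XS]; have [f Pf ->] := pi_surj x.
have [_ [D fD]] := Pf; apply: pi_in_subspace Sl Pf _ fD => u /andP[u0 _].
have Sc c : S (pi (mono K [:: c])).
  by apply: XS; case: c; rewrite /= !inE eqxx ?orbT.
elim: u u0 => // c [|c' u] IHu _ //.
by rewrite pi_mono_cons //; apply: SM => //; exact: IHu.
Qed.

(** The components below the first degree that is not null can be discarded without changing the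
    class; the result has the form that [ev_prime] requires. *)
Lemma low_component f : nonunital_poly f -> pi f != 0 -> exists g m j u v,
  [/\ nonunital_poly g, pi g = pi f, forall w, (size w < m)%N -> g w = 0
    & ev g (j, m, u, v) != 0].
Proof.
move=> Pf fN0; pose Q n := `[< ~ null n f >].
have exQ : exists n, Q n.
  apply: contrapT => H; move/eqP: fN0; apply; apply/pi_eq0 => // n.
  by apply: contrapT => nn; apply: H; exists n; apply/asboolP.
have [m /asboolP mN minm] := ex_minnP exQ.
have [[j [u v]] evN0] : exists s : nat * (seq bool * seq bool), ev f (s.1, m, s.2.1, s.2.2) != 0.
  apply: contrapT => H; apply: mN => j u v; apply/eqP/negPn/negP => N0.
  by apply: H; exists (j, (u, v)).
pose g : ncseries K := fun w => if (size w < m)%N then 0 else f w.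
have Pg : nonunital_poly g.
  have [f0 [D fD]] := Pf; split; first by rewrite /g f0 if_same.
  by exists D => w /fD fw; rewrite /g fw if_same.
exists g, m, j, u, v; split=> //.
- apply/eqP; rewrite -subr_eq0; apply/eqP.
  have PB : nonunital_poly (-1 *: f + g) by exact: nonunital_polyL.
  rewrite addrC -scaleN1r -piL //; apply/pi_eq0 => // n i x y.
  have [ltn|gen] := ltnP n m; last first.
    apply: wsum_eq0 => w sw; rewrite serDE serZE /g sw ltnNge gen /= mulN1r addNr.
    exact: mulr0.
  have nf : null n f.
    apply: contrapT => nn; have : Q n by apply/asboolP.
    by move=> /minm; rewrite leqNgt ltn.
  rewrite evL.
  have -> : (-1 *: ev f + ev g) (i, n, x, y) = -1 * ev f (i, n, x, y) + ev g (i, n, x, y) by [].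
  rewrite nf mulr0 add0r; apply: wsum_eq0 => w sw; rewrite /g sw ltn.
  exact: mulr0.
- by move=> w sw; rewrite /g sw.
- move: evN0; congr (_ != 0); apply: eq_wsum => w sw.
  by rewrite /g sw ltnn.
Qed.

Lemma quot_prime : prime_algebra A.
Proof.
split.
  have [w Bw] := ser_neq0 (B_neq0 0 false); exists (pi (mono K w)).
  have sw : size w = 2%N by rewrite (hom_neq0 (@homB 0%N false) Bw).
  have Pw : nonunital_poly (mono K w) by apply: nonunital_mono; rewrite -size_eq0 sw.
  apply/eqP => /pi_eq0 /(_ (size w) 0%N [::] [::]) H; move/eqP: Bw; apply.
  rewrite -H // /ev -[LHS]pairing_mono; apply: eq_wsum => x _.
  by rewrite cats0.
move=> I J [[I0 _] IM] [[J0 _] JM] IJ0; rewrite !inE in I0 J0.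
have [Iz|/existsNP[x xP]] := pselect (forall x, I x -> x = 0).
  by left; apply/seteqP; split=> [x /Iz //|_ ->].
right; apply/seteqP; split=> [y Jy|_ ->] //; apply: contrapT => yN0.
have /not_implyP[Ix /eqP xN0] := xP.
have [f0 Pf0 xf] := pi_surj x; have [g0 Pg0 yg] := pi_surj y.
move/eqP: yN0; rewrite yg => yN0; rewrite xf in xN0.
have [f [m [i [u [v [Pf ef flow evf]]]]]] := low_component Pf0 xN0.
have [g [n [j [u' [v' [Pg eg glow evg]]]]]] := low_component Pg0 yN0.
have [z [s /eqP]] := ev_prime flow glow evf evg; apply.
(* The empty word is the unit of the series and has no class in the algebra, hence a separate
   case. *)
have [z0|zN0] := eqVneq z [::].
  rewrite z0 [mono K [::] * g](mul1r g) -e_pi; last exact: nonunital_polyM.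
  rewrite piM // ef eg -xf -yg IJ0 // -pi0 e_pi; last exact: nonunital_poly0.
  by case: s => -[[? ?] ?] ?; apply: wsum_eq0 => w _; rewrite ser0E mulr0.
have Pz := nonunital_mono zN0; have Pzg := nonunital_polyM Pz Pg.
rewrite -e_pi; last exact: nonunital_polyM.
rewrite piM // piM // ef eg -xf -yg IJ0 //; last exact: (JM _ _ Jy).1.
rewrite -pi0 e_pi; last exact: nonunital_poly0.
by case: s => -[[? ?] ?] ?; apply: wsum_eq0 => w _; rewrite ser0E mulr0.
Qed.

Lemma quot_radical :
  (forall f, nonunital_poly f -> exists j, forall b u v,
     wsum (l j) (fun w => B j b w * geom f (u ++ w ++ v)) = 0) ->
  radical_algebra A.
Proof.
move=> kf; split; last by [].
split.
  split; first by split=> [|x y]; rewrite !inE.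
  by [].
move=> x _; have [f Pf ->] := pi_surj x; have [j kj] := kf f Pf.
(* As (1 + f) geom f = 1, the quasi-inverse of f is geom f - 1. By [null_killed] its components of
   degree at least [D] are null, so the polynomial [T] of the lower ones represents it. *)
pose D := (2 * l j)%N.
pose T : ncseries K := fun w => if (size w < D)%N then (geom f - 1) w else 0.
have PT : nonunital_poly T.
  split; last by exists D => w sw; rewrite /T ltnNge ltnW.
  rewrite /T; case: ifP => // _; rewrite serBE ser1E eqxx /geom /= big_ord1 expr0 ser1E eqxx.
  exact: subrr.
have PfT := nonunital_polyM Pf PT.
have PD := nonunital_polyD (nonunital_polyD Pf PT) PfT.
exists (pi T); rewrite -piM // -!piD //; last exact: nonunital_polyD.
apply/pi_eq0 => //; pose T' := geom f - 1 - T.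
have ne : ev T' = 0.
  apply/ev_eq0 => n i u v; have [ltn|gen] := ltnP n D.
    apply: wsum_eq0 => w sw; rewrite /T' serBE /T sw ltn subrr.
    exact: mulr0.
  rewrite -[RHS](null_killed kj gen i u v); apply: eq_wsum => w sw; congr (_ * _).
  rewrite /T' serBE /T sw ltnNge gen /= subr0 serBE ser1E.
  have -> : (w == [::]) = false.
    by apply/negbTE; rewrite -size_eq0 sw; have := l_gt0 j; rewrite /D in gen; lia.
  by rewrite subr0.
have -> : f + T + f * T = -1 *: T' + -1 *: (f * T').
  apply/funext => w; have := congr1 (@^~ w) (geom_eq Pf.1); rewrite /T' /= serDE => gw.
  by rewrite !mulrBr mulr1 !(serDE, serZE, serNE) -gw; ring.
apply/ev_eq0; rewrite evL ne scaler0 add0r -[_ *: (f * T')]addr0 evL (ev_ideal f ne).2 scaler0 add0r.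
by apply/funext => -[[[? ?] ?] ?]; apply: wsum_eq0 => w _; rewrite ser0E mulr0.
Qed.

Lemma quot_not_nil : ~ nil_algebra A.
Proof.
pose f : ncseries K := mono K [:: false] + mono K [:: true; true].
have Pf : nonunital_poly f by apply: nonunital_polyD; exact: nonunital_mono.
move=> /(_ (pi f)) [n]; apply/eqP.
have Pfn k : nonunital_poly (f ^+ k.+1).
  by elim: k => [|k IHk]; [rewrite expr1 | rewrite exprS; exact: nonunital_polyM].
have -> : iter n (numul (pi f)) (pi f) = pi (f ^+ n.+1).
  elim: n => [|n IHn]; first by rewrite expr1.
  by rewrite iterS IHn -piM // -exprS.
apply/eqP => /(pi_eq0 (Pfn n)) /ev_eq0 H.
by have := ev_tile_power n; rewrite -/f H eqxx.
Qed.

(** The prefix code i |-> a^i b, which embeds words over infinitely many variables into words over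
    two letters. *)
Definition prefix_code (w : seq nat) : seq bool := flatten [seq rcons (nseq i false) true | i <- w].

Lemma prefix_code_rcons (w : seq nat) i :
  prefix_code (rcons w i) = prefix_code w ++ rcons (nseq i false) true.
Proof. by rewrite /prefix_code -[rcons w i]cats1 map_cat flatten_cat /= cats0. Qed.

Lemma prefix_code_inj : injective prefix_code.
Proof.
have fx i s : find id (rcons (nseq i false) true ++ s) = i.
  by rewrite -cats1 -catA find_cat has_nseq andbF size_nseq /= addn0.
have sx i s : (0 < size (rcons (nseq i false) true ++ s))%N by rewrite size_cat size_rcons.
rewrite /prefix_code; elim=> [|i w IHw] [|i' w'] //= eqw.
- by have := sx i' (prefix_code w'); rewrite -eqw.
- by have := sx i (prefix_code w); rewrite eqw.
have ei : i = i' by rewrite -(fx i (prefix_code w)) eqw fx.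
by move/eqP: eqw; rewrite ei eqseq_cat // => /andP[_ /eqP/IHw ->].
Qed.

(** Substitute for variable i the product of dual elements along its code word. For w0 in the
    support of f, a stage with E_j = q [prefix_code w0] has a functional that reads off the
    coefficient of w0 alone, up to a nonzero scalar. *)
Lemma quot_not_PI : (forall y, exists j, E j = true :: y) -> ~ PI_algebra A.
Proof.
move=> Eall [f [[w0 fw0] f0 fid]].
have [j Ej] := Eall (prefix_code w0).
have [a [ha pa]] := dual_pair j; have [s [k [kN0 evk]]] := ev_word ha pa Ej.
pose x i := bprod a (rcons (nseq i false) true).
have Pa y : y != [::] -> nonunital_poly (bprod a y).
  case: y => // b y _; have := hom_bprod (y := b :: y) ha; have := l_gt0 j.
  by case: (l j) => // L _; rewrite /= mulSn addSn => /nonunital_hom.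
have code0 i w : rcons (nseq i false) true ++ w != [::] by rewrite -size_eq0 size_cat size_rcons.
have Px i : nonunital_poly (x i) by apply: Pa; have := code0 i [::]; rewrite cats0.
have eval (w : seq nat) : w != [::] -> eval_word (fun i => pi (x i)) w = pi (bprod a (prefix_code w)).
  case: w => // i w _; elim/last_ind: w => [|w i' IHw].
    by rewrite /= /prefix_code /= cats0.
  rewrite /= foldl_rcons -/(eval_word _ (i :: w)) IHw -piM //; last first.
    by apply: Pa; exact: code0.
  congr pi; rewrite /x -bprod_cat; congr (bprod a _).
  by rewrite -[in RHS]rcons_cons prefix_code_rcons.
have := fid (fun i => pi (x i)); rewrite /eval_ncpoly.
have -> : \sum_(w <- finsupp f) f w *: eval_word (fun i => pi (x i)) w =
    pi (\sum_(w <- finsupp f) f w *: (if w == [::] then 0 else bprod a (prefix_code w))).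
  rewrite pi_sum; last first.
    move=> w; case: eqP => [_|/eqP w0N]; first exact: nonunital_poly0.
    by apply: Pa; case: w w0N => // i w _; exact: code0.
  apply: eq_bigr => w _; case: eqP => [->|/eqP wN0]; first by rewrite f0 !scale0r.
  by rewrite eval.
move=> /(congr1 e) /(congr1 (@^~ s)); rewrite -pi0 !e_pi; last 2 first.
- exact: nonunital_poly0.
- apply: nonunital_poly_sum => w; case: eqP => [_|/eqP w0N]; first exact: nonunital_poly0.
  by apply: Pa; case: w w0N => // i w _; exact: code0.
have ev0 : ev 0 s = 0.
  by case: s {evk} => -[[? ?] ?] ?; apply: wsum_eq0 => w _; rewrite ser0E mulr0.
rewrite ev0 ev_sum => /eqP; apply/negP.
have w0in : w0 \in finsupp f by rewrite mem_finsupp.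
rewrite (bigD1_seq w0) ?fset_uniq //= big1 ?addr0 => [|w ww0].
  have [w00|_] := eqVneq w0 [::]; first by rewrite w00 f0 eqxx in fw0.
  by rewrite evk eqxx mulr1 mulf_neq0.
case: eqP => _; first by rewrite ev0 mulr0.
by rewrite evk (inj_eq prefix_code_inj) (negPf ww0) !mulr0.
Qed.

(** * Growth of the algebra *)

Definition bounded_degree (n : nat) : set A :=
  [set x | exists f, [/\ nonunital_poly f, forall w, (n < size w)%N -> f w = 0 & x = pi f]].

Lemma bounded_degree_subspace n : linear_subspace (bounded_degree n).
Proof.
apply/linear_subspaceP; split.
  by exists 0; split=> //; [exact: nonunital_poly0 | rewrite pi0].
move=> c x y [f [Pf fn ->]] [g [Pg gn ->]]; exists (c *: f + g); split; last by rewrite piL.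
- exact: nonunital_polyL.
- by move=> w sw; rewrite serDE serZE fn // gn // mulr0 addr0.
Qed.

Lemma grade_letter c : grade 1 (pi (mono K [:: c])).
Proof. by exists (mono K [:: c]); split=> //; [exact: nonunital_mono | exact: (hom_mono [:: c])]. Qed.

Lemma space_exp_grade k : space_exp (grade 1) k `<=` grade k.+1.
Proof.
elim: k => [|k IHk] //=; apply: lspan_min; first exact: grade_subspace.
move=> _ [x [f [Pf hf ->]] [y /IHk [g [Pg hg ->]] <-]]; exists (f * g); split.
- exact: nonunital_polyM.
- exact: (homM hf hg).
- by rewrite piM.
Qed.

Lemma space_exp_mono u : u != [::] -> space_exp (grade 1) (size u).-1 (pi (mono K u)).
Proof.
case: u => // c u _; elim: u c => [|c' u IHu] c; first exact: grade_letter.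
rewrite pi_mono_cons //=; apply: sub_lspan.
exists (pi (mono K [:: c])); first exact: grade_letter.
by exists (pi (mono K (c' :: u))) => //; exact: IHu.
Qed.

Lemma space_sumE n : space_sum (grade 1) n = bounded_degree n.
Proof.
apply/seteqP; split.
  apply: lspan_min; first exact: bounded_degree_subspace.
  move=> x [k /= ltk /space_exp_grade [f [Pf hf ->]]]; exists f; split=> // w sw.
  by rewrite hf // neq_ltn (leq_ltn_trans ltk sw) orbT.
move=> _ [f [Pf fn ->]]; apply: pi_in_subspace (lspan_subspace _) Pf _ fn.
move=> u /andP[u0 un]; apply: sub_lspan; exists (size u).-1; first by rewrite /= prednK.
by apply: space_exp_mono; rewrite -size_eq0 -lt0n.
Qed.

(** Among more than N elements, some nontrivial combination of representatives satisfies the N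
    conditions; it is null in degrees up to n and zero above. *)
Lemma bounded_degree_indep n N m (x : 'I_m -> A) :
  codim_le (fun f => forall k, (k < n.+1)%N -> null k f) N ->
  (forall i : 'I_m, bounded_degree n (x i)) -> lin_indep x -> (m <= N)%N.
Proof.
move=> [I [th [cI thL thP]]] /choice[f fP] indx; rewrite leqNgt; apply/negP => ltN.
have Pf (i : 'I_m) : nonunital_poly (f i) by have [] := fP i.
have [c [i ci] cv] := nontrivial_solution (fun (i : 'I_m) (k : I) => th k (f i)) (leq_ltn_trans cI ltN).
have th0 (k : I) : th k 0 = 0.
  by have := thL k (-1) 0 0; rewrite scaler0 addr0 mulN1r addNr.
have thS (k : I) (s : seq 'I_m) : th k (\sum_(i <- s) c i *: f i) = \sum_(i <- s) c i * th k (f i).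
  by elim: s => [|a s IHs]; rewrite ?big_nil // !big_cons thL IHs.
have S0 : \sum_i c i *: x i = 0.
  have xE (a : 'I_m) : x a = pi (f a) by have [] := fP a.
  under eq_bigr => a _ do rewrite xE.
  rewrite -pi_sum //; apply/(pi_eq0 (nonunital_poly_sum _ _ Pf)).
  move=> k; have [ltk|gek] := ltnP k n.+1.
    by apply: thP => // t; rewrite thS cv.
  move=> j u v; apply: wsum_eq0 => w sw; rewrite ser_sumE big1 ?mulr0 // => a _.
  by have [_ fan _] := fP a; rewrite serZE fan ?mulr0 // sw.
by have /eqP := indx c S0 i; rewrite (negPf ci).
Qed.

Lemma space_sum_dim n : (0 < n)%N -> forall i, (n < l i.+1)%N ->
  [/\ finite_dim (space_sum (grade 1) n), (growth (grade 1) n <= 6 * n ^ 2 * stage_bound i)%N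
    & forall m (x : 'I_m -> A), (forall i : 'I_m, bounded_degree n (x i)) -> lin_indep x ->
       (m <= growth (grade 1) n)%N].
Proof.
move=> n0 i ltn; rewrite /growth space_sumE; apply: ldimP; first exact: bounded_degree_subspace.
by move=> m x; exact: bounded_degree_indep (codim_null_upto n0 ltn).
Qed.

Lemma growth_leq i n : (0 < n)%N -> (n < l i.+1)%N ->
  (growth (grade 1) n <= 6 * n ^ 2 * stage_bound i)%N.
Proof. by move=> n0 ltn; have [] := space_sum_dim n0 ltn. Qed.

Lemma finite_dim_grade1 : finite_dim (grade 1).
Proof.
have -> : grade 1 = space_sum (grade 1) 1.
  rewrite space_sumE; apply/seteqP; split=> _ [f [Pf f1 ->]]; exists f; split=> //.
  - by move=> w sw; rewrite f1 // neq_ltn sw orbT.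
  - by move=> [|c [|c' w]] //= _; [exact: Pf.1 | rewrite f1].
by have [] := @space_sum_dim 1 isT 1 (leq_trans (ltn_l 1) (leq_l (leqnSn 1))).
Qed.

(** The marked words with t, t' <= r are (r + 1)^2 in number, and the coordinates of [ev_marked]
    show that their classes are independent. *)
Lemma growth_geq j y : E j = true :: y ->
  ((r j).+1 ^ 2 <= growth (grade 1) ((2 * r j + size (E j) + M j) * l j))%N.
Proof.
move=> Ey; set n := (_ * l j)%N.
have n0 : (0 < n)%N by rewrite muln_gt0 l_gt0 andbT Ey /= addnS.
have ltn : (n < l n.+1)%N by exact: leq_trans (ltn_l n) (leq_l (leqnSn n)).
have [_ _ maxg] := space_sum_dim n0 ltn.
have [a [ha pa]] := dual_pair j; have [n1 len1 cN0] := tail_coef j.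
pose S := ('I_(r j).+1 * 'I_(r j).+1)%type.
pose F (s : S) := bprod a (marked_word y (M j) n1 s.1 s.2).
have szF (s : S) : size (marked_word y (M j) n1 s.1 s.2) = (s.1 + size (E j) + M j + s.2)%N.
  by rewrite !size_cat !size_nseq Ey /=; lia.
have hF (s : S) := hom_bprod (y := marked_word y (M j) n1 s.1 s.2) ha.
have PF (s : S) : nonunital_poly (F s).
  have := hF s; rewrite szF; have -> : ((s.1 + size (E j) + M j + s.2) * l j =
      ((s.1 + size (E j) + M j + s.2) * l j).-1.+1)%N.
    by rewrite prednK // muln_gt0 l_gt0 andbT Ey /=; lia.
  exact: nonunital_hom.
have -> : ((r j).+1 ^ 2)%N = #|{: S}| by rewrite card_prod card_ord mulnn.
apply: (maxg _ (fun i : 'I_#|{: S}| => pi (F (enum_val i)))) => [i|c].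
  exists (F (enum_val i)); split=> // w sw; rewrite /F (hF (enum_val i)) // neq_ltn; apply/orP; right.
  apply: leq_ltn_trans sw; rewrite szF /n leq_mul2r; apply/orP; right.
  by case: (enum_val i) => s1 s2 /=; have := ltn_ord s1; have := ltn_ord s2; lia.
rewrite -pi_sum // => /pi_eq0 c0 i.
have /ev_eq0 {}c0 := c0 (nonunital_poly_sum _ _ (fun i : 'I_#|{: S}| => PF (enum_val i))).
have le1 := ltn_ord (enum_val i).1; have le2 := ltn_ord (enum_val i).2.
have [s [k [kN0 evs]]] := ev_marked ha pa Ey len1 cN0 le1 le2.
have := congr1 (@^~ s) c0; rewrite ev_sum (bigD1 i) //= big1 ?addr0 => [|i' ni].
  by rewrite evs !eqxx mulr1 => /eqP; rewrite mulf_eq0 (negPf kN0) orbF => /eqP.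
rewrite evs; case: eqP => [e1|_]; last by rewrite /= !mulr0.
case: eqP => [e2|_]; last by rewrite /= !mulr0.
case/eqP: ni; apply: enum_val_inj.
by case: (enum_val i') (enum_val i) e1 e2 => [a1 a2] [b1 b2] /= /val_inj -> /val_inj ->.
Qed.

End QuotientAlgebra.

End Tower.

(** * From growth to Gelfand-Kirillov dimension *)

Section GrowthRate.
Variables (R : realType) (g l s r q : nat -> nat).
Hypotheses (ltl : forall i, (i < l i)%N)
  (g_le : forall i n, (0 < n)%N -> (l i <= n)%N -> (n < l i.+1)%N -> (g n <= 6 * n ^ 2 * s i)%N)
  (s_le : forall i, (s i ^ i <= l i)%N)
  (ltr_ : forall j, (j < r j)%N) (ltq : forall j, (j < q j)%N)
  (g_ge : forall j, (r j ^ 2 <= g (q j))%N)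
  (q_le : forall j, (q j ^ j <= r j ^ j.+1)%N).

Lemma littleo_natP (u v : nat -> R) :
  ((u : nat -> R^o) =o_\oo (v : nat -> R^o)) <->
  forall eps, 0 < eps -> exists N, forall n, (N <= n)%N -> `|u n| <= eps * `|v n|.
Proof.
rewrite eqoP; split=> H eps eps0.
  by have [N _ HN] := H _ eps0; exists N => n leN; exact: HN.
by have [N HN] := H _ eps0; exists N => // n /= leN; exact: HN.
Qed.

Lemma stage_of n i0 : (l i0 <= n)%N -> exists i, (i0 <= i)%N /\ (l i <= n < l i.+1)%N.
Proof.
move=> le0; have ex0 : exists j, (l j <= n)%N by exists i0.
have bnd j : (l j <= n)%N -> (j <= n)%N by move=> le; apply: leq_trans (ltnW (ltl j)) le.
have [j lej maxj] := ex_maxnP ex0 bnd; exists j; split; first exact: maxj.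
by rewrite lej ltnNge; apply/negP => /maxj; rewrite ltnn.
Qed.

(** For n at stage i >= i0, s_i <= x = n^(1/i0), so g n <= 6 n^2 x. Taking 2 / i0 <= d - 2 bounds
    n^d below by n^2 x^2, and the spare factor x exceeds 6 / eps for large n. *)
Lemma growth_upper (d : R) : 2 < d ->
  ((fun n => (g n)%:R : R^o) =o_\oo (fun n => n%:R `^ d : R^o)).
Proof.
move=> d2; apply/(littleo_natP (fun n => (g n)%:R) (fun n => n%:R `^ d)) => eps eps0.
have [i1 i1P] : exists i1 : nat, 2 / (d - 2) <= i1%:R :> R.
  exists (Num.bound (2 / (d - 2))); apply/ltW/archi_boundP.
  by rewrite divr_ge0 // subr_ge0 ltW.
pose i0 := i1.+1; have i0P : 2 / i0%:R <= d - 2 :> R.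
  rewrite ler_pdivrMr ?ltr0n // mulrC -ler_pdivrMr ?subr_gt0 //.
  by apply: le_trans i1P _; rewrite ler_nat.
pose N2 := Num.bound ((6 / eps) ^+ i0); exists (l i0 + N2)%N => n len.
have [i [lei /andP[li ln]]] := stage_of (leq_trans (leq_addr _ _) len).
have n0 : (0 < n)%N by apply: leq_trans (leq_trans (leq_addr _ _) len); exact: leq_trans (ltl i0).
have nR0 : 0 < n%:R :> R by rewrite ltr0n.
pose x : R := n%:R `^ i0%:R^-1.
have x0 : 0 < x by exact: powR_gt0.
have xn : x ^+ i0 = n%:R.
  by rewrite -powR_mulrn ?(ltW x0) // /x -powRrM mulVf ?pnatr_eq0 // powRr1.
have sx : (s i)%:R <= x.
  rewrite -(@ler_pXn2r _ i0) ?nnegrE ?ler0n ?(ltW x0) // xn -natrX ler_nat.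
  case: (posnP (s i)) => [->|s0]; first by rewrite exp0n.
  by apply: leq_trans li; apply: leq_trans (s_le i); rewrite leq_pexp2l.
have ex : 6 / eps <= x.
  have e0 : 0 <= 6 / eps by rewrite divr_ge0 ?(ltW eps0).
  rewrite -(@ler_pXn2r _ i0) ?nnegrE ?(ltW x0) // xn.
  apply: (le_trans (ltW (archi_boundP (exprn_ge0 _ e0)))).
  by rewrite ler_nat; exact: leq_trans (leq_addl _ _) len.
rewrite !ger0_norm ?powR_ge0 ?ler0n //.
apply: (@le_trans _ _ (6 * n%:R ^+ 2 * x)).
  apply: (@le_trans _ _ (6 * n ^ 2 * s i)%N%:R); first by rewrite ler_nat g_le.
  have -> : (6 * n ^ 2 * s i)%N%:R = 6 * n%:R ^+ 2 * (s i)%:R :> R by rewrite -natrX -!natrM.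
  by rewrite ler_wpM2l // mulr_ge0 // exprn_ge0.
have -> : n%:R `^ d = n%:R ^+ 2 * n%:R `^ (d - 2).
  by rewrite -powR_mulrn ?ler0n // -powRD ?(gt_eqF nR0) ?implybT // addrC subrK.
have xx : x ^+ 2 <= n%:R `^ (d - 2).
  rewrite -powR_mulrn ?(ltW x0) // /x -powRrM; apply: ler_powR; first by rewrite ler1n.
  by rewrite mulrC.
have e1 : 6 <= eps * x by rewrite mulrC -ler_pdivrMr.
apply: (@le_trans _ _ (eps * (n%:R ^+ 2 * x ^+ 2))).
  have -> : eps * (n%:R ^+ 2 * x ^+ 2) = (eps * x) * (n%:R ^+ 2 * x) by ring.
  rewrite -mulrA ler_wpM2r // mulr_ge0 ?exprn_ge0 // ltW //.
by rewrite ler_wpM2l ?(ltW eps0) // ler_wpM2l ?exprn_ge0.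
Qed.

(** At n = q_j the growth is at least r_j^2, whereas q_j <= r_j^(1 + 1/j). An exponent d < 2 would
    make q_j^d smaller than r_j^2 for large j. *)
Lemma growth_lower (d : R) :
  ((fun n => (g n)%:R : R^o) =o_\oo (fun n => n%:R `^ d : R^o)) -> 2 <= d.
Proof.
move=> /(littleo_natP (fun n => (g n)%:R) (fun n => n%:R `^ d)) /(_ 1 ltr01) [N HN].
(* Raising d to at least 1 makes the power function of exponent d' monotone. *)
rewrite leNgt; apply/negP => d2; pose d' := Num.max d 1.
have d'1 : 1 <= d' by rewrite le_max lexx orbT.
have d'2 : d' < 2 by rewrite gt_max d2 ltr1n.
(* The bound comes from j (2 - d') >= d' + 1, that is (j + 1) d' <= 2 j - 1; the 1 lost against 2 j
   gives the strict inequality. *)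
pose N1 := Num.bound ((d' + 1) / (2 - d')); pose j := (N + N1).+1.
have jP : j.+1%:R * d' <= (2 * j - 1)%N%:R.
  have : (d' + 1) / (2 - d') <= j%:R.
    apply: (le_trans (ltW (archi_boundP _))); last by rewrite ler_nat /j leqW // leq_addl.
    by rewrite divr_ge0 ?subr_ge0 ?(ltW d'2) // addr_ge0 // (le_trans ler01).
  rewrite ler_pdivrMr ?subr_gt0 // => H.
  rewrite natrB ?natrM; last by rewrite /j; lia.
  by rewrite -natr1; lra.
have r1 : (1 < r j)%N by apply: leq_trans (ltr_ j); rewrite /j.
have q0 : (0 < q j)%N by exact: leq_ltn_trans (ltq j).
have := HN (q j); rewrite mul1r !ger0_norm ?powR_ge0 ?ler0n //.
move=> /(_ (leq_trans (leq_trans (leq_addr _ _) (leqnSn _)) (ltnW (ltq j)))); apply/negP; rewrite -ltNge.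
apply: (@le_lt_trans _ _ ((q j)%:R `^ d')).
  by apply: ler_powR; rewrite ?ler1n // le_max lexx.
apply: (@lt_le_trans _ _ ((r j ^ 2)%N%:R)); last by rewrite ler_nat.
rewrite -(@ltr_pXn2r _ j) ?nnegrE ?powR_ge0 ?ler0n //.
rewrite -powR_mulrn ?powR_ge0 // powRAC powR_mulrn ?ler0n //.
apply: (@le_lt_trans _ _ (((r j)%:R ^+ j.+1) `^ d')).
  apply: ge0_ler_powR; rewrite ?nnegrE ?exprn_ge0 ?ler0n //; first exact: le_trans d'1.
  by rewrite -!natrX ler_nat.
rewrite -powR_mulrn ?ler0n // -powRrM.
apply: (@le_lt_trans _ _ ((r j)%:R `^ (2 * j - 1)%N%:R)).
  by apply: ler_powR => //; rewrite ler1n ltnW.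
rewrite powR_mulrn ?ler0n // -!natrX ltr_nat -expnM ltn_exp2l //.
by rewrite /j; lia.
Qed.

Lemma ereal_inf_growth :
  ereal_inf [set d%:E | d in [set d : R | (fun n => (g n)%:R : R^o) =o_\oo
                 (fun n => n%:R `^ d : R^o)]] = 2%:E.
Proof.
apply/eqP; rewrite eq_le; apply/andP; split.
  apply/lee_addgt0Pr => eps eps0; apply: ereal_inf_lbound; exists (2 + eps) => //.
  by apply: growth_upper; rewrite ltrDl.
by apply: le_ereal_inf_tmp => _ [d /growth_lower d2 <-]; rewrite lee_fin.
Qed.

End GrowthRate.

(** * Choice of the parameters of the tower *)

Theorem corollary2p4 (K : countFieldType) (R : realType) :
  exists A : nuAlgType K,
    (exists (G : nat -> set A) (X : seq A),
       [/\ is_grading G, (forall x, x \in X -> G 1%N x)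
         & generates [set` X]]) /\
    [/\ prime_algebra A, radical_algebra A, ~ nil_algebra A, ~ PI_algebra A
      & has_GKdim A (2%:E : \bar R)].
Proof.
have ratK j := geom_rational (nth_poly_nonunital K j).
pose I j := sval (cid (ratK j)).
have ratI j : exists e : I j -> ncseries K, forall u v, exists c : I j -> K,
  forall w, geom (nth_poly K j) (u ++ w ++ v) = \sum_i c i * e i w := svalP (cid (ratK j)).
pose e j := sval (cid (ratI j)).
have eP j u v : exists c : I j -> K, forall w,
  geom (nth_poly K j) (u ++ w ++ v) = \sum_i c i * e j i w := svalP (cid (ratI j)) u v.
(* As j varies, [E j] runs over all words that begin with q. *)
pose E (j : nat) : seq bool := true :: odflt [::] (choice.unpickle j).
pose M (j : nat) := #|I j|.+1.
(* The first term makes stage_bound negligible before l, for the upper bound on the growth;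
   the second one is for the lower bound. *)
pose rr j l := (stage_bound E M j.+1 ^ j.+1 + (3 * l) ^ j + size (E j) + M j + j + 2)%N.
have [l [B [C [[l0 lS] B0 gB BS kB]]]] := tower_exists e E (M := M) rr (fun j => leqnn _).
pose r j := rr j (l j).
have r_gt1 j : (1 < r j)%N by rewrite /r /rr addn2.
have [A [pi [ea [ea_inj ea_pi pi_surj piL piM]]]] :=
  quotient_nualg (@nonunital_poly0 K) (@nonunital_polyL K) (@nonunital_polyM K) (evL B)
   (fun f g _ _ => ev_ideal (B := B) g (f := f)).
have lS' j : l j.+1 = ((r j + size (E j) + M j) * l j)%N by exact: lS.
have BS' j b : B j.+1 b =
  \sum_(n < (M j).+1) C j b n *: bprod (B j) (zword (r j) (E j) (M j) n) by exact: BS.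
have l_gt := ltn_l l0 lS' gB r_gt1.
exists A; split.
  exists (grade pi), [:: pi (mono K [:: false]); pi (mono K [:: true])]; split.
  - exact: (grade_grading ea_inj ea_pi pi_surj piL piM).
  - by move=> x; rewrite !inE => /orP[] /eqP ->; exact: grade_letter.
  - exact: (letters_generate pi_surj piL piM).
split.
- exact: (quot_prime l0 lS' gB BS' r_gt1 ea_inj ea_pi pi_surj piL piM).
- apply: (quot_radical l0 lS' gB BS' r_gt1 ea_inj ea_pi pi_surj piL piM) => f Pf.
  (* Stage j + 1 kills the functions [e j], whose combinations include all the middle parts of
     [geom f] for the j-th polynomial f. *)
  have [j <-] := nth_poly_surj Pf; exists j.+1 => b u v; have [c cE] := eP j u v.
  under eq_wsum => w _ do rewrite cE mulr_sumr.
  rewrite wsum_big big1 // => i _; under eq_wsum => w _ do rewrite mulrCA.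
  by rewrite wsumMl -/(pairing _ _ _) kB mulr0.
- exact: (quot_not_nil l0 lS' gB r_gt1 ea_inj ea_pi piL piM).
- apply: (quot_not_PI gB BS' ea_pi piL piM) => y; exists (choice.pickle y).
  by rewrite /E choice.pickleK.
exists (grade pi 1); split.
- exact: (grade_subspace piL 1%N).
- exact: (finite_dim_grade1 l0 lS' gB BS' r_gt1 B0 ea_inj ea_pi piL piM).
- apply/seteqP; split=> // x _ S [Ssub gS].
  have := letters_generate pi_surj piL piM; move=> /seteqP[_ /(_ x Logic.I)]; apply; split=> //.
  by move=> y /=; rewrite !inE => /orP[] /eqP ->; apply: gS; exact: grade_letter.
have Eg j : ((r j).+1 ^ 2 <= growth (grade pi 1) ((2 * r j + size (E j) + M j) * l j))%N.
  exact: (growth_geq l0 lS' gB BS' r_gt1 B0 ea_inj ea_pi piL piM (erefl (E j))).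
have rE j : r j = (stage_bound E M j.+1 ^ j.+1 + (3 * l j) ^ j + size (E j) + M j + j + 2)%N by [].
apply: (@ereal_inf_growth R _ l (stage_bound E M) r
  (fun j => (2 * r j + size (E j) + M j) * l j)%N).
- exact: l_gt.
- move=> i n n0 _ ltn; exact: (growth_leq l0 lS' gB BS' r_gt1 B0 ea_inj ea_pi piL piM n0 ltn).
(* The bound for stage i + 1 already enters r_i, with exponent i + 1, and r_i <= l_{i+1}. *)
- case=> [|i]; first by rewrite expn0 l0.
  apply: leq_trans (_ : r i <= _)%N; first by rewrite rE -!addnA leq_addr.
  by rewrite lS' -addnA mulnDl (leq_trans _ (leq_addr _ _)) // leq_pmulr // (leq_ltn_trans _ (l_gt i)).
- by move=> j; rewrite rE addn2 ltnS leqW // leq_addl.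
- move=> j; apply: leq_trans (l_gt j) _; rewrite leq_pmull //.
  by rewrite -addnA addn_gt0 muln_gt0 (ltnW (r_gt1 j)).
- by move=> j; apply: leq_trans (Eg j); rewrite leq_exp2r.
- move=> j; have [->|j0] := posnP j; first by rewrite !expn0 expn1 ltnW.
  (* Since r_j exceeds |E_j| + M_j, the degree is at most 3 r_j l_j; and r_j also exceeds (3
     l_j)^j. *)
  apply: (@leq_trans ((r j * (3 * l j)) ^ j)).
    rewrite leq_exp2r // mulnA leq_mul2r; apply/orP; right.
    by rewrite [X in (_ <= X)%N]mulnC -addnA mulSn addnC leq_add2r rE; lia.
  rewrite expnMn expnSr leq_mul2l; apply/orP; right.
  by rewrite rE -!addnA; apply: leq_trans (leq_addl _ _); exact: leq_addr.
Qed.
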